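(* Let $k\ge 2$ and let $X_1,\dots ,X_k\subset \mathbb{P}^n$ be integral varieties. Then for a general $(g_1,\dots ,g_k)\in PGL(n+1)^k$ one has $$\dim \bigl(g_1(X_1)\star\cdots \star g_k(X_k)\bigr) =\min \{n,\dim X_1+\cdots +\dim X_k\}.$$
   Context: $\mathbb{P}^n$ is the $n$-dimensional complex projective space with a fixed system of homogeneous coordinates $x_0,\dots ,x_n$. $PGL(n+1)=\mathrm{Aut}(\mathbb{P}^n)$ is the quotient of $GL(n+1)$ by the non-zero multiples of the identity matrix. Varieties here are closed subvarieties of $\mathbb{P}^n$. Hadamard product of points: for $P=[p_0:\dots :p_n]$ and $Q=[q_0:\dots :q_n]$ in $\mathbb{P}^n$ with $p_iq_i\ne 0$ for at least one $i$, $P\star Q:=[p_0q_0:\dots :p_nq_n]\in\mathbb{P}^n$; if $p_iq_i=0$ for all $i$, $P\star Q$ is not defined. For $k$ points the product is coordinatewise in the same way, and is well-defined when some coordinate of the product is non-zero. Hadamard product of varieties: let $X_1,\dots ,X_k\subset\mathbb{P}^n$ be irreducible subvarieties such that $P_1\star\cdots\star P_k$ is well-defined for at least one $(P_1,\dots ,P_k)\in X_1\times\cdots\times X_k$. Then it is well-defined on a non-empty Zariski open subset of $X_1\times\cdots\times X_k$, and $X_1\star\cdots\star X_k$ is the Zariski closure in $\mathbb{P}^n$ of the set of all well-defined products $P_1\star\cdots\star P_k$ with $P_j\in X_j$. ''For a general $(g_1,\dots ,g_k)$'' means for all elements of some non-empty Zariski open subset of $PGL(n+1)^k$ (depending on the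 $X_i$). *)

(* Defs.v *)
From HB Require Import structures.
From mathcomp Require Export all_boot all_order all_algebra.
From mathcomp Require Export generic_quotient.
From mathcomp Require Export classical_sets reals.
From mathcomp Require Export complex.
From mathcomp Require Export mpoly.

Set Implicit Arguments.
Unset Strict Implicit.
Unset Printing Implicit Defensive.

Import GRing.Theory.
Local Open Scope ring_scope.
Local Open Scope classical_set_scope.
Local Open Scope quotient_scope.

(* A point of P^n is a line through the origin of F^(n+1), and its homogeneous
   coordinates are the nonzero vectors of that line. *)
Definition point (F : fieldType) (n : nat) : Type :=
  {L : {vspace 'cV[F]_n.+1} | \dim L == 1%N}.

Definition coords (F : fieldType) (n : nat) (p : point F n)
    (x : 'cV[F]_n.+1) : Prop :=
  x != 0 /\ x \in val p.

Definition vanishes (F : fieldType) (n : nat) (f : {mpoly F[n.+1]})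
    (p : point F n) : Prop :=
  forall x, coords p x -> f.@[fun j => x j 0] = 0.

Definition zariski_closed (F : fieldType) (n : nat)
    (Z : set (point F n)) : Prop :=
  exists S : set {mpoly F[n.+1]},
    (forall f, S f -> exists d : nat, f \is d.-homog) /\
    Z = [set p | forall f, S f -> vanishes f p].

Definition zariski_closure (F : fieldType) (n : nat)
    (A : set (point F n)) : set (point F n) :=
  [set p | forall Z, zariski_closed Z -> A `<=` Z -> Z p].

Definition irreducible (F : fieldType) (n : nat)
    (X : set (point F n)) : Prop :=
  X !=set0 /\
  forall Z1 Z2, zariski_closed Z1 -> zariski_closed Z2 ->
    X `<=` Z1 `|` Z2 -> X `<=` Z1 \/ X `<=` Z2.

(* An integral (reduced and irreducible) closed subscheme of P^n over an
   algebraically closed field is determined by its set of closed points. *)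
Definition integral_variety (F : fieldType) (n : nat)
    (X : set (point F n)) : Prop :=
  zariski_closed X /\ irreducible X.

(* Z_0 < ... < Z_m, of length m, inside X. *)
Definition has_chain (F : fieldType) (n : nat) (X : set (point F n))
    (m : nat) : Prop :=
  exists Z : nat -> set (point F n),
    (forall i, (i <= m)%N -> integral_variety (Z i) /\ Z i `<=` X) /\
    (forall i, (i < m)%N -> Z i `<` Z i.+1).

(* For X Zariski closed, the irreducible closed subsets of the space X are the
   integral varieties contained in X, so this is the Krull dimension of X.
   The empty set has no dimension. *)
Definition has_dim (F : fieldType) (n : nat) (X : set (point F n))
    (d : nat) : Prop :=
  has_chain X d /\ forall m, has_chain X m -> (m <= d)%N.

(* q = P_1 * ... * P_k; no such q exists when all the coordinatewise products
   are zero, since coordinates of q are required to be nonzero. *)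
Definition hadamard_point (F : fieldType) (n k : nat)
    (P : 'I_k -> point F n) (q : point F n) : Prop :=
  exists x : 'I_k -> 'cV[F]_n.+1,
    (forall i, coords (P i) (x i)) /\
    coords q (\col_j \prod_(i < k) x i j 0).

Definition hadamard_products (F : fieldType) (n k : nat)
    (X : 'I_k -> set (point F n)) : set (point F n) :=
  [set q | exists2 P : 'I_k -> point F n,
             (forall i, X i (P i)) & hadamard_point P q].

Definition hadamard (F : fieldType) (n k : nat)
    (X : 'I_k -> set (point F n)) : set (point F n) :=
  zariski_closure (hadamard_products X).

Definition GL (F : fieldType) (n : nat) : Type :=
  {A : 'M[F]_n | A \in unitmx}.
HB.instance Definition _ (F : fieldType) (n : nat) := Choice.on (GL F n).

Definition scalar_multiple (F : fieldType) (n : nat) (A B : GL F n) : bool :=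
  val A \in <[val B]>%VS.

Lemma scalar_multiple_is_equiv (F : fieldType) (n : nat) :
  equiv_class_of (@scalar_multiple F n).
Proof.
split=> [A|A B|B A C]; rewrite /scalar_multiple ?memv_line//; last first.
  by move=> /vlineP[a ->] /vlineP[b ->]; apply/memvZ/memvZ/memv_line.
have sym (M N : GL F n) : val M \in <[val N]>%VS -> val N \in <[val M]>%VS.
  move=> /vlineP[a eMN]; have [a0|a_neq0] := eqVneq a 0; last first.
    apply/vlineP; exists a^-1.
    by rewrite eMN scalerA mulVf// scale1r.
  move: (valP M) (valP N); rewrite eMN a0 scale0r => u0 _.
  have : (1%:M : 'M[F]_n) = 0 by rewrite -(mulVmx u0) mulmx0.
  by move=> e; rewrite -[val N]mulmx1 e mulmx0 mem0v.
by apply/idP/idP; apply: sym.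
Qed.

Canonical scalar_multiple_equiv (F : fieldType) (n : nat) :=
  EquivRelPack (@scalar_multiple_is_equiv F n).

Definition PGL (F : fieldType) (n : nat) : Type :=
  {eq_quot (@scalar_multiple_equiv F n)}.

Definition maps_to (F : fieldType) (n : nat) (g : PGL F n.+1)
    (p q : point F n) : Prop :=
  exists (A : GL F n.+1) (x : 'cV[F]_n.+1),
    [/\ \pi_(PGL F n.+1) A = g, coords p x & coords q (val A *m x)].

Definition image_by (F : fieldType) (n : nat) (g : PGL F n.+1)
    (X : set (point F n)) : set (point F n) :=
  [set q | exists2 p, X p & maps_to g p q].

(* The k n^2 entries of a k-tuple of matrices. *)
Definition entries (F : fieldType) (n k : nat) (A : 'I_k -> GL F n) :
    'I_(k * (n * n)) -> F :=
  fun a => mxvec (\matrix_(i < k) mxvec (val (A i))) 0 a.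

(* The Zariski topology of PGL(n)^k is the quotient topology of GL(n)^k, a
   Zariski open subset of the affine space of k-tuples of matrices. *)
Definition zariski_open_PGL (F : fieldType) (n k : nat)
    (U : set ('I_k -> PGL F n)) : Prop :=
  exists S : set {mpoly F[k * (n * n)]},
    forall A : 'I_k -> GL F n,
      U (fun i => \pi_(PGL F n) (A i)) <->
      exists2 f, S f & f.@[entries A] != 0.

(* Main.v *)
(* Everything is done with the cones over the varieties.  For closed X, Noether
   normalization gives linear forms u_0..u_m, algebraically independent on X,
   over which the coordinate ring of X is finite; then forms of degree t span a
   space of dimension O(t^m) on X.  A chain of length l in X yields (s+1)^(l+1)
   independent polynomials of degree O(s), hence l <= m.  Conversely X contains a
   chain of length m: by lying over (a common eigenvector of commuting matrices)
   the u_i stay independent on a minimal closed subset, which is irreducible, and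
   u_0..u_(m-1) stay independent on its section by u_m = 0.

   Upper bound: a form of degree t evaluated at a Hadamard product of the X_i is a
   combination of products of forms of degree t on the X_i, so the dimension is
   at most the sum of the d_i.

   Lower bound: cut X_i by linear spaces to Z_i of dimension a_i, where the a_i add
   up to e = min(n, sum d_i).  The first e+1 coordinates of the Hadamard product
   of the g_i Z_i are linear forms on the Segre embedding of the product of the
   Z_i.  That the coordinate ring of the Segre variety is finite over them is a
   condition on the g_i implied by the non-vanishing of a determinant, and it
   holds for suitable (non-invertible) matrices.  As the Segre variety carries
   e+1 algebraically independent linear forms, finiteness forces these e+1
   coordinates to be algebraically independent. *)

Require Import Defs.
From mathcomp Require Import boolp zify ring.

Set Implicit Arguments.
Unset Strict Implicit.
Unset Printing Implicit Defensive.

Import Order.TTheory GRing.Theory Num.Theory.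
Local Open Scope ring_scope.
Local Open Scope classical_set_scope.

(** * Evaluating multivariate polynomials *)

Section Evaluation.
Context (F : numClosedFieldType).

Lemma poly_nonroot (p : {poly F}) : p != 0 -> exists t, p.[t] != 0.
Proof.
move=> p0; apply: contrapT => noroot.
(* The integers from 0 to [size p - 1] would be too many roots; they are distinct because the
   characteristic is zero. *)
suff : (size [seq (i%:R : F) | i <- iota 0 (size p)] < size p)%N.
  by rewrite size_map size_iota ltnn.
apply: max_poly_roots p0 _ _.
  apply/allP => x _; rewrite /root; apply/negPn/negP => px.
  by apply: noroot; exists x.
rewrite map_inj_uniq ?iota_uniq// => i j /eqP.
by rewrite eqr_nat => /eqP.
Qed.

Lemma muni_meval (n : nat) (f : {mpoly F[n.+1]}) (v : 'I_n.+1 -> F) :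
  f.@[v] = (map_poly (meval (fun i => v (widen_ord (leqnSn n) i))) (muni f)).[v ord_max].
Proof.
rewrite mevalE muniE rmorph_sum horner_sum; apply: eq_bigr => m _ /=.
rewrite map_polyZ map_polyXn hornerZ hornerXn /= (mevalZ (fun i => v (widen_ord (leqnSn n) i))) mevalX.
rewrite big_ord_recr /= mulrA; congr (_ * _ * _).
by apply: eq_bigr => i _; rewrite mnmE.
Qed.

Lemma muni_eq0 (n : nat) (f : {mpoly F[n.+1]}) : muni f = 0 -> f = 0.
Proof.
move=> f0; apply/mpolyP => m0; rewrite mcoeff0.
have := congr1 (fun p : {poly {mpoly F[n]}} =>
  (p`_(m0 ord_max))@_[multinom m0 (widen_ord (leqnSn n) i) | i < n]) f0.
rewrite coef0 mcoeff0 muniE coef_sum raddf_sum /=.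
have E (m : 'X_{1..n.+1}) :
  ([multinom m (widen_ord (leqnSn n) i) | i < n] ==
   [multinom m0 (widen_ord (leqnSn n) i) | i < n]) && (m ord_max == m0 ord_max)
  = (m == m0).
  apply/andP/eqP => [[/eqP/mnmP e /eqP e']|-> //].
  apply/mnmP => i; case: (unliftP ord_max i) => [j ->|-> //].
  have -> : lift ord_max j = widen_ord (leqnSn n) j.
    by apply/val_inj; rewrite /= /bump leqNgt ltn_ord.
  by have := e j; rewrite !mnmE.
under eq_bigr => m _.
  rewrite coefZ coefXn mulr_natr mcoeffMn mcoeffZ mcoeffX -mulrnAr -mulrnA mulnb [_ ord_max == _]eq_sym E.
  over.
have [m0f|m0f] := boolP (m0 \in msupp f); last by rewrite (memN_msupp_eq0 m0f).
rewrite (bigD1_seq m0)//= ?msupp_uniq// eqxx mulr1 big1 ?addr0// => m /negPf ->.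
by rewrite mulr0.
Qed.

(** Induction on the number of variables: at a point where the leading coefficient in the last
    variable is non-zero, a non-zero polynomial in that variable remains. *)
Lemma mpoly_nonroot (n : nat) (f : {mpoly F[n]}) : f != 0 -> exists v, f.@[v] != 0.
Proof.
elim: n f => [|n IH] f f0.
  exists (fun=> 0); move: f0; rewrite {1}(nvar0_mpolyC f) mpolyC_eq0.
  by rewrite {2}(nvar0_mpolyC f) mevalC.
have mf0 : muni f != 0 by apply: contra f0 => /eqP /muni_eq0 ->.
have /IH[v vP] : lead_coef (muni f) != 0 by rewrite lead_coef_eq0.
have /poly_nonroot[t tP] : map_poly (meval v) (muni f) != 0.
  apply: contra vP => /eqP e; rewrite lead_coefE -coef_map /= e coef0.
  by [].
exists (fun i => if unlift ord_max i is Some j then v j else t).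
rewrite muni_meval unlift_none.
rewrite (eq_map_poly (g := meval v))// => p; apply: meval_eq => i; case: unliftP => [j /(congr1 val)/= e|/(congr1 val)/= e].
  by congr v; apply/val_inj; move: e; rewrite /bump leqNgt ltn_ord.
by have := ltn_ord i; rewrite e ltnn.
Qed.

Lemma meval_scale (n d : nat) (f : {mpoly F[n]}) (t : F) (v : 'I_n -> F) :
  f \is d.-homog -> f.@[fun i => t * v i] = t ^+ d * f.@[v].
Proof.
move=> /dhomogP fd; rewrite !mevalE mulr_sumr; apply: eq_big_seq => m mf.
rewrite mulrCA; congr (_ * _); rewrite -(fd _ mf) /= mdegE.
by rewrite expr_sum -big_split; apply: eq_bigr => i _; rewrite /= exprMn.
Qed.

(** Along a line through the origin [f] becomes a polynomial in [t] whose coefficients are the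
    values of its homogeneous components at [v]; having infinitely many roots, it is zero. *)
Lemma pihomog_vanish (n : nat) (f : {mpoly F[n]}) (v : 'I_n -> F) :
  (forall t, t != 0 -> f.@[fun i => t * v i] = 0) ->
  forall d, (pihomog mdeg d f).@[v] = 0.
Proof.
move=> f0 d; pose p := \poly_(i < msize f) (pihomog mdeg i f).@[v].
have p0 : p = 0.
  apply/eqP; apply: contrapT => /negP p0.
  (* The factor ['X] ensures that the non-root [t] is non-zero, so that the hypothesis applies to
     it. *)
  have /poly_nonroot[t] : 'X * p != 0 by rewrite mulf_neq0 ?polyX_eq0.
  rewrite hornerM hornerX mulf_eq0 negb_or => /andP[t0] /eqP; apply.
  rewrite horner_poly -[RHS](f0 t t0) [in RHS](pihomog_partitionE (leqnn (msize f))).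
  rewrite raddf_sum /=; apply: eq_bigr => i _.
  by rewrite (meval_scale _ _ (pihomogP _ _ _)) mulrC.
have [df|df] := ltnP d (msize f).
  by have := congr1 (fun q : {poly F} => q`_d) p0; rewrite coef_poly df coef0.
suff -> : pihomog mdeg d f = 0 by rewrite meval0.
rewrite pihomogE big1_seq// => m /andP[/eqP md].
by rewrite (negPf (msize_mdeg_ge _))// md.
Qed.

Lemma homog0E (n : nat) (f : {mpoly F[n]}) :
  f \is 0.-homog -> f = (f@_0%MM)%:MP.
Proof.
move=> f0; apply/mpolyP => m; rewrite mcoeffC; have [->|m0] := eqVneq m 0%MM.
  by rewrite mulr1.
by rewrite mulr0 (@dhomog_nemf_coeff _ _ mdeg 0)//= mdeg_eq0.
Qed.

End Evaluation.

(** * Independence and growth of function spaces *)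

Lemma leq_expl (m n e : nat) : (m <= n)%N -> (m ^ e <= n ^ e)%N.
Proof. by case: e => [|e] mn; rewrite ?expn0// leq_exp2r. Qed.

Section Growth.
Context (F : numClosedFieldType).

Definition indep_on (T : Type) (I : finType) (phi : I -> T -> F) : Prop :=
  forall c : I -> F, (forall w, \sum_i c i * phi i w = 0) -> forall i, c i = 0.

Definition spanned (T : Type) (A : set (T -> F)) (r : nat) : Prop :=
  exists psi : nat -> T -> F, forall f, A f ->
    exists c : nat -> F, forall w, f w = \sum_(a < r) c a * psi a w.

Lemma spanned_fin (T : Type) (A : set (T -> F)) (r : nat) (J : finType)
    (psi : J -> T -> F) :
  (#|J| <= r)%N ->
  (forall f, A f -> exists c : J -> F, forall w, f w = \sum_j c j * psi j w) ->
  spanned A r.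
Proof.
move=> Jr h.
exists (fun a w => if insub a is Some i then psi (enum_val (i : 'I_#|J|)) w else 0).
move=> f /h[c fE].
exists (fun a => if insub a is Some i then c (enum_val (i : 'I_#|J|)) else 0).
move=> w; rewrite fE; pose G a :=
  (if insub a is Some i then c (enum_val (i : 'I_#|J|)) else 0) *
  (if insub a is Some i then psi (enum_val (i : 'I_#|J|)) w else 0).
rewrite -[RHS]/(\sum_(a < r) G a); transitivity (\sum_(a < #|J|) G a).
  rewrite (reindex (@enum_val J predT)) /=; last exact/onW_bij/enum_val_bij.
  apply: eq_bigr => a _; rewrite /G insubT //= => h'.
  by rewrite (_ : Sub _ _ = a)//; apply/val_inj.
rewrite (big_ord_widen _ G Jr) big_mkcond; apply: eq_bigr => a _.
by case: ifP => // /negbT ja; rewrite /G insubN ?mul0r.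
Qed.

Lemma indep_spanned (T : Type) (A : set (T -> F)) (r : nat) (I : finType)
    (phi : I -> T -> F) :
  indep_on phi -> (forall i, A (phi i)) -> spanned A r -> (#|I| <= r)%N.
Proof.
move=> ind Aphi [psi h].
have /choice[c cE] : forall i, exists c : nat -> F,
  forall w, phi i w = \sum_(a < r) c a * psi a w by move=> i; exact: h.
pose M : 'M[F]_(#|I|, r) := \matrix_(i, a) c (enum_val i) a.
suff : row_free M by move=> /eqP <-; apply: rank_leq_col.
rewrite -kermx_eq0; apply/eqP/row_matrixP => k; rewrite row0.
set v := row k _.
have vM : v *m M = 0 by apply/sub_kermxP; rewrite row_sub.
have {}ind := ind (fun i => v 0 (enum_rank i)).
apply/rowP => j; rewrite !mxE -[j]enum_valK.
have := ind _ (enum_val j); rewrite !mxE => -> // w.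
under eq_bigr do rewrite cE mulr_sumr.
rewrite exchange_big big1 // => a _.
under eq_bigr do rewrite mulrA.
have -> : \sum_i v 0 (enum_rank i) * c i a * psi a w = (v *m M) 0 a * psi a w.
  rewrite mxE mulr_suml (reindex (@enum_val I predT)) /=; last exact/onW_bij/enum_val_bij.
  by apply: eq_bigr => i _; rewrite !mxE enum_valK.
by rewrite vM mxE mul0r.
Qed.

(** A bound O(t^d) on the Hilbert function of the image of [p]. *)
Definition hgrowth (T : Type) (N : nat) (p : T -> 'I_N -> F) (d : nat) : Prop :=
  exists C : nat, forall t : nat,
    spanned [set g | exists2 f : {mpoly F[N]}, f \is t.-homog &
                     g = fun w => f.@[p w]] (C * t.+1 ^ d).

(** A polynomial of degree at most [t] has [t + 1] homogeneous components, which costs one more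
    power of [t + 1]. *)
Lemma agrowth (T : Type) (N : nat) (p : T -> 'I_N -> F) (d : nat) :
  hgrowth p d -> exists C : nat, forall t : nat,
    spanned [set g | exists2 f : {mpoly F[N]}, (msize f <= t.+1)%N &
                     g = fun w => f.@[p w]] (C * t.+1 ^ d.+1).
Proof.
move=> [C h]; exists C => t.
have [psi psiP] := choice h.
pose r := (C * t.+1 ^ d)%N.
have {}h (t' : 'I_t.+1) f : f \is t'.-homog ->
    exists c : nat -> F, forall w, f.@[p w] = \sum_(a < r) c a * psi t' a w.
  move=> fh; have [|c fE] := psiP t' (fun w => f.@[p w]); first by exists f.
  have rr : (C * t'.+1 ^ d <= r)%N by rewrite leq_mul2l leq_expl ?orbT.
  exists (fun a => if (a < C * t'.+1 ^ d)%N then c a else 0) => w.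
  rewrite fE (big_ord_widen _ (fun a => c a * psi t' a w) rr) big_mkcond.
  by apply: eq_bigr => a _ /=; case: ifP => // _; rewrite mul0r.
apply: (@spanned_fin _ _ _ ('I_t.+1 * 'I_r)%type (fun j w => psi j.1 j.2 w)).
  by rewrite card_prod !card_ord /r expnS mulnCA.
move=> _ [f ft ->].
have /choice[c cP] : forall t' : 'I_t.+1, exists c : nat -> F, forall w,
    (pihomog mdeg t' f).@[p w] = \sum_(a < r) c a * psi t' a w.
  by move=> t'; apply: h; apply: pihomogP.
exists (fun j : 'I_t.+1 * 'I_r => c j.1 j.2) => w.
rewrite [in LHS](pihomog_partitionE ft) raddf_sum /= -(pair_big predT predT
  (fun (t' : 'I_t.+1) (a : 'I_r) => c t' a * psi t' a w)).
by apply: eq_bigr => t' _; rewrite cP.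
Qed.

Lemma growth_compare (T : Type) (N : nat) (p : T -> 'I_N -> F) (m d : nat) :
  (exists D : nat, forall s, exists (I : finType) (phi : I -> {mpoly F[N]}),
    [/\ #|I| = (s.+1 ^ m.+1)%N, forall i, (msize (phi i) <= (D * s).+1)%N
      & indep_on (fun i w => (phi i).@[p w])]) ->
  hgrowth p d -> (m <= d)%N.
Proof.
move=> [D h] /agrowth[C hC]; rewrite leqNgt; apply/negP => dm.
(* At s = K the available dimension is at most K (K+1)^(d+1), because D K + 1 <= (D+1)(K+1); this is
   just below (K+1)^(d+2). *)
pose K := (C * D.+1 ^ d.+1)%N.
have [I [phi [cI phiD phi_ind]]] := h K.
have := indep_spanned phi_ind
  (fun i => ex_intro2 _ _ (phi i) (phiD i) erefl) (hC (D * K)%N).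
rewrite cI; apply/negP; rewrite -ltnNge.
apply: (@leq_ltn_trans (K * K.+1 ^ d.+1)).
  rewrite /K -mulnA leq_mul2l -expnMn leq_expl ?orbT// -/K.
  by rewrite mulSn mulnS; lia.
apply: leq_trans (_ : K.+1 ^ d.+2 <= _)%N; last by rewrite leq_pexp2l.
by rewrite [X in (_ < X)%N]expnS ltn_mul2r expn_gt0 /=.
Qed.

End Growth.

(** * Noether normalization *)

Section Normalization.
Context (F : numClosedFieldType).

Definition ideal (N : nat) (J : set {mpoly F[N]}) : Prop :=
  [/\ J 0, forall f g, J f -> J g -> J (f + g) & forall f g, J g -> J (f * g)].

Definition add_ideal (N m : nat) (J : set {mpoly F[N]})
    (u : 'I_m -> {mpoly F[N]}) : set {mpoly F[N]} :=
  [set f | exists q : 'I_m -> {mpoly F[N]}, J (f - \sum_s u s * q s)].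

(** A graded form of finiteness: for linear forms [u], rewriting the powers ['X_j ^+ T.+1] makes the
    quotient by [J] a finite module over the polynomials in [u]. *)
Definition finite_over (N m : nat) (J : set {mpoly F[N]})
    (u : 'I_m -> {mpoly F[N]}) (T : nat) : Prop :=
  forall j, exists q : 'I_m -> {mpoly F[N]},
    (forall s, q s \is T.-homog) /\ J ('X_j ^+ T.+1 - \sum_s u s * q s).

Definition vanishing (T : Type) (N : nat) (p : T -> 'I_N -> F) : set {mpoly F[N]} :=
  [set f | forall w, f.@[p w] = 0].

(** Stability under non-zero scalars is what makes the vanishing ideal homogeneous. *)
Definition conic (T : Type) (N : nat) (p : T -> 'I_N -> F) : Prop :=
  forall w t, t != 0 -> exists w', forall i, p w' i = t * p w i.

Definition alg_indep (T : Type) (N m : nat) (p : T -> 'I_N -> F)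
    (u : 'I_m -> {mpoly F[N]}) : Prop :=
  forall G : {mpoly F[m]}, (forall w, G.@[fun s => (u s).@[p w]] = 0) -> G = 0.

Definition cmp (N m : nat) (u : 'I_m -> {mpoly F[N]}) (G : {mpoly F[m]}) :
  {mpoly F[N]} := G \mPo [tuple u s | s < m].

Lemma cmp_meval (N m : nat) (u : 'I_m -> {mpoly F[N]}) (G : {mpoly F[m]})
    (v : 'I_N -> F) : (cmp u G).@[v] = G.@[fun s => (u s).@[v]].
Proof. by rewrite /cmp comp_mpoly_meval; apply: meval_eq => s; rewrite tnth_mktuple. Qed.

Lemma idealB (N : nat) (J : set {mpoly F[N]}) f g :
  ideal J -> J f -> J g -> J (f - g).
Proof. by move=> [_ JD JM] Jf Jg; apply: JD => //; rewrite -mulN1r; apply: JM. Qed.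

Lemma ideal_sum (N : nat) (J : set {mpoly F[N]}) (I : Type) (r : seq I)
    (P : pred I) (h : I -> {mpoly F[N]}) :
  ideal J -> (forall i, P i -> J (h i)) -> J (\sum_(i <- r | P i) h i).
Proof. by move=> [J0 JD _] Jh; apply: (big_ind J). Qed.

Lemma ideal_exp (N : nat) (J : set {mpoly F[N]}) f g e :
  ideal J -> J (f - g) -> J (f ^+ e - g ^+ e).
Proof. by move=> [_ _ JM] Jfg; rewrite subrXX mulrC; apply: JM. Qed.

Lemma vanishing_ideal (T : Type) (N : nat) (p : T -> 'I_N -> F) :
  ideal (vanishing p).
Proof.
split=> [w|f g f0 g0 w|f g g0 w]; first exact: meval0.
  by rewrite mevalD f0 g0 addr0.
by rewrite mevalM g0 mulr0.
Qed.

Lemma vanishing_pihomog (T : Type) (N : nat) (p : T -> 'I_N -> F) f d :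
  conic p -> vanishing p f -> vanishing p (pihomog mdeg d f).
Proof.
move=> pc f0 w; apply: pihomog_vanish => t /(pc w)[w' w'E].
by rewrite -(meval_eq _ w'E).
Qed.

Lemma add_ideal_ideal (N m : nat) (J : set {mpoly F[N]}) (u : 'I_m -> {mpoly F[N]}) :
  ideal J -> ideal (add_ideal J u).
Proof.
move=> [J0 JD JM]; split.
- by exists (fun=> 0); rewrite big1 ?subr0// => s _; rewrite mulr0.
- move=> f g [q qf] [q' qg]; exists (fun s => q s + q' s).
  under eq_bigr do rewrite mulrDr.
  by rewrite big_split opprD addrACA; apply: JD.
- move=> f g [q qg]; exists (fun s => f * q s).
  under eq_bigr do rewrite mulrCA.
  by rewrite -mulr_sumr -mulrBr; apply: JM.
Qed.

Lemma add_ideal_sub (N m : nat) (J : set {mpoly F[N]}) (u : 'I_m -> {mpoly F[N]}) f :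
  J f -> add_ideal J u f.
Proof. by exists (fun=> 0); rewrite big1 ?subr0// => s _; rewrite mulr0. Qed.

Lemma add_ideal_gen (N m : nat) (J : set {mpoly F[N]}) (u : 'I_m -> {mpoly F[N]}) s :
  ideal J -> add_ideal J u (u s).
Proof.
move=> [J0 _ _]; exists (fun s' => (s' == s)%:R).
rewrite (bigD1 s)//= eqxx mulr1 big1 ?addr0 ?subrr// => s' /negPf ->.
by rewrite mulr0.
Qed.

Lemma cmp_congr (N m : nat) (J : set {mpoly F[N]}) (u v : 'I_m -> {mpoly F[N]}) G :
  ideal J -> (forall s, J (u s - v s)) -> J (cmp u G - cmp v G).
Proof.
move=> Ji Juv; have [J0 JD JM] := Ji.
elim/mpolyind: G => [|c m' G _ _ IH]; first by rewrite /cmp !comp_mpoly0 subr0.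
rewrite /cmp !comp_mpolyD opprD addrACA; apply: (JD) => //.
rewrite !comp_mpolyZ -scalerBr -mul_mpolyC; apply: (JM).
rewrite !comp_mpolyX; under eq_bigr do rewrite tnth_mktuple.
under [X in _ - X]eq_bigr do rewrite tnth_mktuple.
apply: (big_rec2 (fun y x => J (y - x))) => [|s x y _ IH']; first by rewrite subrr.
have -> : u s ^+ m' s * x - v s ^+ m' s * y
  = u s ^+ m' s * (x - y) + y * (u s ^+ m' s - v s ^+ m' s) by ring.
by apply: JD; apply: JM => //; apply: ideal_exp.
Qed.

Lemma pihomog_mul1 (N : nat) (u q : {mpoly F[N]}) d : u \is 1.-homog ->
  pihomog mdeg d.+1 (u * q) = u * pihomog mdeg d q.
Proof.
move=> u1; have qK : (msize q <= maxn (msize q) d.+1)%N by rewrite leq_maxl.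
have dK : (d < maxn (msize q) d.+1)%N by rewrite leq_max ltnSn orbT.
rewrite [in LHS](pihomog_partitionE qK) mulr_sumr raddf_sum /=.
rewrite (bigD1 (Ordinal dK))//= big1 => [|e ed].
  by rewrite addr0 pihomog_dE// (dhomogM u1 (pihomogP _ _ _)).
apply: pihomog_ne0 (dhomogM u1 (pihomogP _ _ _)).
by rewrite add1n eqSS; apply: contra ed => /eqP ed; apply/eqP/val_inj.
Qed.

(** Raising to a common exponent and taking the homogeneous component of that degree turns
    nilpotence of the variables modulo [u] into graded relations. *)
Lemma finite_over_add_ideal (N m : nat) (J : set {mpoly F[N]})
    (u : 'I_m -> {mpoly F[N]}) :
  ideal J -> (forall f d, J f -> J (pihomog mdeg d f)) ->
  (forall s, u s \is 1.-homog) ->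
  (forall j, exists e, add_ideal J u ('X_j ^+ e)) ->
  exists T, finite_over J u T.
Proof.
move=> Ji Jh u1 /choice[e eP].
pose E := (\sum_j e j)%N; exists E => j.
have [q qP] : add_ideal J u ('X_j ^+ E.+1).
  have ejE : (e j <= E.+1)%N by rewrite /E (bigD1 j)//= ltnW// ltnS leq_addr.
  rewrite -(subnK ejE) exprD.
  by have [_ _ JM] := add_ideal_ideal u Ji; apply: JM.
exists (fun s => pihomog mdeg E (q s)); split; first by move=> s; apply: pihomogP.
move: (Jh _ E.+1 qP); rewrite pihomogB.
have -> : pihomog mdeg E.+1 (\sum_s u s * q s) = \sum_s u s * pihomog mdeg E (q s).
  by rewrite raddf_sum; apply: eq_bigr => s _; apply: pihomog_mul1.
rewrite pihomog_dE//; have := @dhomogMn _ _ mdeg 1 ('X_j : {mpoly F[N]}) E.+1.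
by rewrite mul1n; apply; rewrite dhomogX /= mdeg1.
Qed.

(** Graded Nakayama as an induction principle: modulo [J], forms are built from monomials with all
    exponents at most [T] by linear combinations and multiplication by the [u s]. *)
Lemma finite_over_ind (N m : nat) (J : set {mpoly F[N]})
    (u : 'I_m -> {mpoly F[N]}) (T : nat) (P : nat -> {mpoly F[N]} -> Prop) :
  ideal J -> finite_over J u T ->
  (forall t, P t 0) -> (forall t f g, P t f -> P t g -> P t (f + g)) ->
  (forall t c f, P t f -> P t (c *: f)) ->
  (forall t f g, J (f - g) -> P t g -> P t f) ->
  (forall t s f, P t f -> P t.+1 (u s * f)) ->
  (forall m' : 'X_{1..N}, (forall i, m' i < T.+1)%N -> P (mdeg m') 'X_[m']) ->
  forall t f, f \is t.-homog -> P t f.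
Proof.
move=> [J0 JD JM] fin P0 PD PZ PJ Pu PM t.
elim/ltn_ind: t => t IH f /dhomogP ft.
rewrite (mpolyE f) big_seq; apply: (big_ind (P t)) => [|g h|m' mf]; [exact: P0|exact: PD|].
apply: PZ; have /= <- := ft _ mf.
have [mT|/existsNP[i /negP]] := pselect (forall i, m' i < T.+1)%N; first exact: PM.
rewrite -leqNgt => Tm.
(* An exponent above [T] lets the factor X_i^(T+1) be replaced by the sum of the u_s q_s; the
   cofactors of the u_s then have degree t - 1. *)
have [q [qh qJ]] := fin i.
have mE : m' = ((m' - U_(i) *+ T.+1) + U_(i) *+ T.+1)%MM.
  rewrite submK//; apply/mnm_lepP => j; rewrite mulmnE mnm1E.
  by case: eqP => [<-|_]; rewrite ?mul1n ?mul0n.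
set m1 := (m' - U_(i) *+ T.+1)%MM in mE.
have mt : t = (mdeg m1 + T).+1.
  by have /= <- := ft _ mf; rewrite mE mdegD mdegMn mdeg1 mul1n addnS.
apply: (PJ _ _ ('X_[m1] * \sum_s u s * q s)).
  by rewrite mE mpolyXD -mpolyXn -mulrBr; apply: JM.
have /= -> := ft _ mf; rewrite mulr_sumr; apply: (big_ind (P t)) => [|g h|s _]; [exact: P0|exact: PD|].
rewrite mulrCA mt; apply: Pu; apply: IH; first by rewrite mt.
by apply: dhomogM (qh s); rewrite dhomogX.
Qed.

Lemma finite_over_growth (T0 : Type) (N m : nat) (p : T0 -> 'I_N -> F)
    (u : 'I_m.+1 -> {mpoly F[N]}) (T : nat) :
  finite_over (vanishing p) u T -> hgrowth p m.
Proof.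
move=> fin; exists (T.+1 ^ N)%N => t.
pose J := ({ffun 'I_N -> 'I_T.+1} * {ffun 'I_m -> 'I_t.+1})%type.
(* Reduced monomials times monomials in [u]. The total degree fixes the exponent of the last form,
   so only [m] exponents in [u] are free and the count is O(t^m). *)
pose psi (j : J) w := \prod_i p w i ^+ j.1 i *
  (\prod_(s < m) (u (widen_ord (leqnSn m) s)).@[p w] ^+ j.2 s *
   (u ord_max).@[p w] ^+ (t - (\sum_i j.1 i + \sum_s j.2 s))).
apply: (@spanned_fin _ _ _ _ J psi); first by rewrite card_prod !card_ffun !card_ord.
move=> _ [f ft ->].
(* Membership in the span is encoded impredicatively, so that in the step multiplying by [u s] the
   hypothesis can be used with the predicate [fun g => Q (u s * g)]. *)
pose P t' f := forall Q : {mpoly F[N]} -> Prop, Q 0 ->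
  (forall f g, Q f -> Q g -> Q (f + g)) ->
  (forall c f, Q f -> Q (c *: f)) ->
  (forall f g, vanishing p (f - g) -> Q g -> Q f) ->
  (forall (mu : 'X_{1..N}) (a : 'X_{1..m.+1}), (forall i, mu i < T.+1)%N ->
     (mdeg mu + mdeg a)%N = t' -> Q ('X_[mu] * \prod_s u s ^+ a s)) -> Q f.
suff h : forall t f, f \is t.-homog -> P t f.
  apply: (h t f ft (fun f => exists c : J -> F, forall w,
    f.@[p w] = \sum_j c j * psi j w)) => {f ft h}.
  - by exists (fun=> 0) => w; rewrite meval0 big1// => j _; rewrite mul0r.
  - move=> f g [c fE] [c' gE]; exists (fun j => c j + c' j) => w.
    by rewrite mevalD fE gE -big_split; apply: eq_bigr => j _; rewrite mulrDl.
  - move=> c f [c' fE]; exists (fun j => c * c' j) => w.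
    by rewrite mevalZ fE mulr_sumr; apply: eq_bigr => j _; rewrite mulrA.
  - move=> f g fg [c gE]; exists c => w; rewrite -gE; apply/eqP.
    by rewrite -subr_eq0 -mevalB fg.
  - move=> mu a muT mut; have ale s : (a s < t.+1)%N.
      by rewrite ltnS -mut (mdegE a) (bigD1 s)//= addnCA leq_addr.
    pose j0 : J := ([ffun i => Ordinal (muT i)],
      [ffun s => Ordinal (ale (widen_ord (leqnSn m) s))]).
    exists (fun j => (j == j0)%:R) => w.
    rewrite (bigD1 j0)//= eqxx mul1r [X in _ + X]big1 => [|j /negPf ->]; last by rewrite mul0r.
    rewrite addr0 mevalM mevalX rmorph_prod /= /psi; congr (_ * _).
      by apply: eq_bigr => i _; rewrite ffunE.
    rewrite big_ord_recr /=; congr (_ * _).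
      by apply: eq_bigr => s _; rewrite ffunE rmorphXn.
    rewrite rmorphXn /=; congr (_ ^+ _).
    have -> : (\sum_i j0.1 i = mdeg mu)%N.
      by rewrite mdegE; apply: eq_bigr => i _; rewrite ffunE.
    have -> : (\sum_s j0.2 s = \sum_(i < m) a (widen_ord (leqnSn m) i))%N.
      by apply: eq_bigr => i _; rewrite ffunE.
    by rewrite -mut (mdegE a) big_ord_recr addnA addKn.
move=> {f ft}; apply: (finite_over_ind (vanishing_ideal p) fin).
- by move=> t' Q.
- by move=> t' f g fP gP Q Q0 QD QZ QJ QM; apply: (QD); [exact: (fP Q)|exact: (gP Q)].
- by move=> t' c f fP Q Q0 QD QZ QJ QM; apply: (QZ); exact: (fP Q).
- by move=> t' f g fg fP Q Q0 QD QZ QJ QM; apply: (QJ _ _ fg); exact: (fP Q).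
- move=> t' s f fP Q Q0 QD QZ QJ QM; apply: (fP (fun g => Q (u s * g))).
  + by rewrite mulr0.
  + by move=> g h; rewrite mulrDr; apply: QD.
  + by move=> c g; rewrite -scalerAr; apply: QZ.
  + move=> g h gh; apply: QJ => w; rewrite -mulrBr.
    by have [_ _ JM] := vanishing_ideal p; apply: JM.
  + move=> mu a muT mut; have -> : u s * ('X_[mu] * \prod_s u s ^+ a s) =
        'X_[mu] * \prod_s' u s' ^+ (a + U_(s))%MM s'.
      rewrite mulrCA; congr (_ * _); rewrite [RHS](bigD1 s)//= (bigD1 s)//= mulrA.
      rewrite mnmDE mnm1E eqxx addn1 exprS; congr (_ * _).
      by apply: eq_bigr => s' /negPf ss; rewrite mnmDE mnm1E eq_sym ss addn0.
    by apply: QM => //; rewrite mdegD mdeg1 addnA mut addn1.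
- move=> mu muT Q Q0 QD QZ QJ QM.
  have := QM mu 0%MM muT; rewrite big1 ?mulr1; last by move=> s _; rewrite mnm0E.
  by apply; rewrite mdeg0 addn0.
Qed.

End Normalization.

(** * Elimination of dependent linear forms *)

Section NoetherNormalization.
Context (F : numClosedFieldType).

Lemma conic_lin (T0 : Type) (N m : nat) (p : T0 -> 'I_N -> F)
    (u : 'I_m -> {mpoly F[N]}) :
  conic p -> (forall s, u s \is 1.-homog) -> conic (fun w s => (u s).@[p w]).
Proof.
move=> pc u1 w t /(pc w)[w' w'E]; exists w' => s.
by rewrite (meval_eq _ w'E) (meval_scale _ _ (u1 s)) expr1.
Qed.

(** Each homogeneous component of a relation is a relation. Its degree is positive, since a non-zero
    constant does not vanish on an inhabited set. *)
Lemma alg_dep_homog (T0 : Type) (m : nat) (p : T0 -> 'I_m -> F) (G : {mpoly F[m]}) :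
  conic p -> inhabited T0 -> G != 0 -> vanishing p G ->
  exists d (H : {mpoly F[m]}),
    [/\ (0 < d)%N, H \is d.-homog, H != 0 & vanishing p H].
Proof.
move=> pc [w0] G0 Gp.
have [d Gd] : exists d, pihomog mdeg d G != 0.
  apply: contrapT => /forallNP h; move/eqP: G0; apply.
  rewrite (pihomog_partitionE (leqnn (msize G))) big1// => d _.
  by apply/eqP/negPn/negP; apply: h.
exists d, (pihomog mdeg d G); have Gv := vanishing_pihomog d pc Gp.
split => //; last exact: pihomogP.
rewrite lt0n; apply: contra Gd => /eqP d0.
have GE := homog0E (pihomogP mdeg 0 G); rewrite -d0 in GE.
by have := Gv w0; rewrite GE mevalC => ->; rewrite mpolyC0.
Qed.

Lemma noether_step (T0 : Type) (N m : nat) (p : T0 -> 'I_N -> F)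
    (u : 'I_m.+1 -> {mpoly F[N]}) (T : nat) :
  conic p -> inhabited T0 -> (forall s, u s \is 1.-homog) ->
  finite_over (vanishing p) u T -> ~ alg_indep p u ->
  exists (u' : 'I_m -> {mpoly F[N]}) (T' : nat),
    (forall s, u' s \is 1.-homog) /\ finite_over (vanishing p) u' T'.
Proof.
move=> pc T0i u1 fin /existsNP[G /not_implyP[Gv /eqP G0]].
have [d [H [d0 /[dup] Hd /dhomogP Hh H0 Hv]]] := alg_dep_homog (conic_lin pc u1) T0i G0 Gv.
have [a Ha] := mpoly_nonroot H0.
have [s0 as0] : exists s0, a s0 != 0.
  apply: contrapT => /forallNP a0; move: Ha; rewrite (meval_eq (v2 := fun s => 0 * a s)).
    by rewrite (meval_scale _ _ Hd) expr0n eqn0Ngt d0 mul0r eqxx.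
  by move=> s; rewrite mul0r; apply/eqP/negPn/negP; apply: a0.
pose lam s := a s / a s0.
pose u' s := u (lift s0 s) - lam (lift s0 s) *: u s0.
have u'1 s : u' s \is 1.-homog.
  by rewrite /u' rpredB// dhomogZ.
exists u'; pose I := add_ideal (vanishing p) u'.
have vi := vanishing_ideal p.
have Ii : ideal I by apply: add_ideal_ideal.
have [I0 ID IM] := Ii.
have uI s : I (u s - lam s *: u s0).
  case: (unliftP s0 s) => [s' ->|->]; first exact: add_ideal_gen.
  by rewrite /lam divff// scale1r subrr.
(* Modulo [u'] each [u s] equals [lam s *: u s0], so the relation [H] becomes H(lam) (u_s0)^d = 0
   with H(lam) non-zero. *)
have u0I : I (u s0 ^+ d).
  have Hlam : H.@[lam] != 0.
    apply: contra Ha; rewrite (meval_eq (v1 := a) (v2 := fun s => a s0 * lam s)).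
      by rewrite (meval_scale _ _ Hd) => /eqP ->; rewrite mulr0.
    by move=> s; rewrite /lam mulrCA divff// mulr1.
  have -> : u s0 ^+ d = (H.@[lam]^-1)%:MP * (H.@[lam] *: u s0 ^+ d).
    by rewrite mul_mpolyC scalerA mulVf// scale1r.
  apply: (IM).
  have -> : H.@[lam] *: u s0 ^+ d = H.@[lam] *: u s0 ^+ d -
     cmp (fun s => lam s *: u s0) H + (cmp u H - (cmp u H - cmp (fun s => lam s *: u s0) H)).
    by ring.
  apply: ID; last first.
    apply: (idealB Ii); last exact: cmp_congr.
    by apply: add_ideal_sub => w; rewrite cmp_meval.
  apply: add_ideal_sub => w; rewrite mevalB cmp_meval mevalZ rmorphXn /=.
  rewrite [X in _ - X](meval_eq (v2 := fun s => (u s0).@[p w] * lam s)).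
    by rewrite (meval_scale _ _ Hd) mulrC subrr.
  by move=> s; rewrite mevalZ mulrC.
suff [T' finT'] : exists T', finite_over (vanishing p) u' T' by exists T'.
apply: finite_over_add_ideal => //.
  by move=> f e; apply: vanishing_pihomog.
(* Modulo [u'] the power X_j^(T+1) is a multiple of [u s0], whose [d]-th power vanishes. *)
move=> j; exists (T.+1 * d)%N.
have [q [_ qJ]] := fin j; rewrite exprM.
rewrite -[_ ^+ d](subrK (((\sum_s lam s *: q s) * u s0) ^+ d)).
apply: (ID); last by rewrite exprMn; apply: IM.
apply: ideal_exp => //.
have -> : 'X_j ^+ T.+1 - (\sum_s lam s *: q s) * u s0 =
   'X_j ^+ T.+1 - \sum_s u s * q s + \sum_s q s * (u s - lam s *: u s0).
  have -> : \sum_s q s * (u s - lam s *: u s0) =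
      \sum_s u s * q s - (\sum_s lam s *: q s) * u s0.
    rewrite mulr_suml -sumrB; apply: eq_bigr => s _.
    by rewrite -!mul_mpolyC; ring.
  by ring.
apply: (ID); first exact: add_ideal_sub.
by apply: ideal_sum => // s _; apply: IM.
Qed.

Lemma noether_normalization (T0 : Type) (N : nat) (p : T0 -> 'I_N -> F) :
  conic p -> inhabited T0 -> (forall w, exists i, p w i != 0) ->
  exists (m : nat) (u : 'I_m.+1 -> {mpoly F[N]}) (T : nat),
    [/\ forall s, u s \is 1.-homog, finite_over (vanishing p) u T & alg_indep p u].
Proof.
move=> pc T0i p0.
pose P m := exists (u : 'I_m -> {mpoly F[N]}) (T : nat),
    (forall s, u s \is 1.-homog) /\ finite_over (vanishing p) u T.
have PN : `[< P N >].
  apply/asboolP; exists (fun s => 'X_s), 0%N; split => [s|j].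
    by rewrite dhomogX /= mdeg1.
  exists (fun s => (s == j)%:R); split.
    by move=> s; case: eqP => _; [apply: dhomog1|apply: rpred0].
  rewrite (bigD1 j)//= eqxx mulr1 big1 ?addr0 ?expr1 ?subrr//.
    by have [] := vanishing_ideal p.
  by move=> s /negPf ->; rewrite mulr0.
have [m /asboolP[u [T [u1 fin]]] mmin] := ex_minnP (ex_intro (fun m => `[< P m >]) N PN).
case: m u u1 fin mmin => [|m] u u1 fin mmin.
  (* With no forms left, a power of every coordinate would vanish at [w0], where some coordinate is
     non-zero. *)
  have [w0] := T0i; have [i pi] := p0 w0.
  have [q [_ /(_ w0)]] := fin i.
  rewrite big_ord0 subr0 rmorphXn /= mevalXU => /eqP.
  by rewrite expf_eq0 (negPf pi) andbF.
exists m, u, T; split => //; apply: contrapT => /(noether_step pc T0i u1 fin)[u' [T' h]].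
suff /mmin : `[< P m >] by rewrite ltnn.
by apply/asboolP; exists u', T'.
Qed.

End NoetherNormalization.

(** * Lying over *)

Section LyingOver.
Context (F : numClosedFieldType).

(** Among the matrices with rows in [K], one of maximal rank has all of [K] as its row space. *)
Lemma submx_of_closed (r : nat) (K : 'rV[F]_r -> Prop) :
  K 0 -> (forall c x y, K x -> K y -> K (c *: x + y)) ->
  exists B : 'M[F]_r, forall x, K x <-> (x <= B)%MS.
Proof.
move=> K0 KD.
have Kmul k (B : 'M_(k, r)) : (forall i, K (row i B)) -> forall x, K (x *m B).
  move=> KB x; rewrite mulmx_sum_row; apply: (big_ind K) => // [y z Ky Kz|i _].
    by rewrite -[y]scale1r; apply: KD.
  by rewrite -[_ *: _]addr0; apply: KD.
pose P k := `[< exists2 B : 'M[F]_r, (forall i, K (row i B)) & \rank B = k >].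
have P0 : exists k, P k.
  exists 0%N; apply/asboolP; exists 0; last exact: mxrank0.
  by move=> i; rewrite row0.
have Pr k : P k -> (k <= r)%N by move=> /asboolP[B _ <-]; apply: rank_leq_row.
have [k /asboolP[B KB rB] kmax] := ex_maxnP P0 Pr.
exists B => x; split=> [Kx|/submxP[y ->]]; last exact: Kmul.
have : P (\rank (B + x)%MS).
  apply/asboolP; exists (B + x)%MS => // i.
  have /sub_addsmxP[[y z] /= ->] := row_sub i (B + x)%MS.
  rewrite -[y *m B]scale1r; apply: KD; first exact: Kmul.
  by apply: Kmul => i'; rewrite row_id.
move=> /kmax; rewrite -rB => rBx; apply: submx_trans (addsmxSr B x) _.
by have := mxrank_leqif_sup (addsmxSl B x); move=> h; rewrite -(geq_leqif h).
Qed.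

(** Commutation holds only on [V], so the matrices are first restricted to a basis of [V]. *)
Lemma common_eigenvector_on (r : nat) (V : 'M[F]_r) (As : seq 'M[F]_r) :
  V != 0 -> {in As, forall A, stablemx V A} ->
  {in As &, forall A B, V *m (A *m B) = V *m (B *m A)} ->
  exists2 v : 'rV_r, v != 0 & (v <= V)%MS /\ {in As, forall A, exists a, v *m A = a *: v}.
Proof.
move=> V0 VA comm.
have [||v v0 /allP vA] := @common_eigenvector F _ [seq restrictmx V A | A <- As].
- by rewrite lt0n mxrank_eq0.
- move=> _ _ /mapP[A AAs ->] /mapP[B BAs ->].
  rewrite /comm_mx -!conjmxM ?inE ?stablemx_row_base ?VA//.
  rewrite /conjmx; congr (_ *m _); have /submxP[D ->] : (row_base V <= V)%MS by rewrite eq_row_base.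
  by rewrite -!mulmxA comm.
exists (v *m row_base V); first by rewrite mulmx_free_eq0 ?row_base_free.
split; first by rewrite mulmx_sub// eq_row_base.
move=> A AAs; apply/sub_rVP; rewrite -[(_ <= _)%MS]/(stablemx _ _) -stablemx_restrict ?VA//.
by apply: vA; apply/mapP; exists A.
Qed.

(** Modulo [J] the polynomials form a module generated by [W] over the polynomials in [u]. Its fibre
    at [b] is a non-zero finite-dimensional space; a common eigenvector of the dual multiplication
    operators has the coordinates of a point above [b] as eigenvalues. *)
Lemma lying_over_module (N m r : nat) (J : set {mpoly F[N]})
    (u : 'I_m -> {mpoly F[N]}) (W : 'cV[{mpoly F[N]}]_r) :
  ideal J ->
  (forall f, exists G : 'rV[{mpoly F[m]}]_r,
     J (f - (map_mx (cmp u) G *m W) 0 0)) ->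
  (forall G, J (cmp u G) -> G = 0) ->
  forall b : 'I_m -> F, exists xi : 'I_N -> F,
    (forall f, J f -> f.@[xi] = 0) /\ (forall s, (u s).@[xi] = b s).
Proof.
move=> Ji Wgen Jindep b; have [J0 JD JM] := Ji.
pose JX k (A : 'cV[{mpoly F[N]}]_k) := forall i, J (A i 0).
have JXD k (A B : 'cV_k) : JX k A -> JX k B -> JX k (A + B).
  by move=> JA JB i; rewrite mxE; apply: JD.
have JXM k l (A : 'M_(k, l)) (B : 'cV_l) : JX l B -> JX k (A *m B).
  by move=> JB i; rewrite mxE; apply: ideal_sum => // j _; apply: JM.
have JXB k (A B : 'cV_k) : JX k A -> JX k B -> JX k (A - B).
  by move=> JA JB; apply: JXD => // i; rewrite mxE -mulN1r; apply: JM.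
pose cu k l (A : 'M_(k, l)) := map_mx (comp_mpoly [tuple u s | s < m]) A.
pose ev k l (A : 'M[{mpoly F[m]}]_(k, l)) := map_mx (meval b) A.
(* [M j] is a matrix of multiplication by X_j on the generators. *)
have /choice[M ME] : forall j, exists M : 'M[{mpoly F[m]}]_r,
    JX r ('X_j *: W - cu _ _ M *m W).
  move=> j; have /choice[G GE] := fun a => Wgen ('X_j * W a 0).
  exists (\matrix_a G a) => a; have := GE a; congr (J _).
  by rewrite !mxE; congr (_ - _); apply: eq_bigr => c _; rewrite !mxE.
(* [K] collects the values at [b] of the relations between the generators; the fibre is F^r modulo
   [K]. *)
pose K (x : 'rV[F]_r) := exists2 c : 'rV[{mpoly F[m]}]_r,
  JX 1%N (cu _ _ c *m W) & x = ev _ _ c.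
have [||B BK] := @submx_of_closed r K.
- exists 0; last by rewrite /ev map_mx0.
  by move=> i; rewrite /cu map_mx0 mul0mx mxE.
- move=> t _ _ [c cJ ->] [c' c'J ->]; exists (t%:MP *: c + c').
    rewrite /cu map_mxD mulmxDl; apply: JXD; last exact: c'J.
    rewrite map_mxZ -scalemxAl -mul_scalar_mx; exact: (JXM _ _ _ _ cJ).
  by rewrite /ev map_mxD map_mxZ /= mevalC.
(* The determinant trick: if [K] were everything, some relation matrix [C] would be the identity at
   [b]. Its determinant would annihilate [W], hence 1, so it would be zero by independence, yet its
   value at [b] is 1. *)
have Bfull : \rank B != r.
  apply/negP => /eqP rB.
  have /choice[c cE] : forall a : 'I_r, exists c : 'rV[{mpoly F[m]}]_r,
      JX 1%N (cu _ _ c *m W) /\ row a 1%:M = ev _ _ c.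
    move=> a; have [c h1 h2] : K (row a 1%:M).
      by apply/BK; apply: submx_full; rewrite /row_full rB.
    by exists c.
  pose C : 'M_r := \matrix_a c a.
  have CJ : JX r (cu _ _ C *m W).
    move=> a; have [+ _] := cE a => /(_ 0); congr (J _).
    by rewrite !mxE; apply: eq_bigr => e _; rewrite !mxE.
  have C1 : ev _ _ C = 1%:M.
    by apply/row_matrixP => a; have [_ ->] := cE a; apply/rowP => e; rewrite !mxE.
  have [G GJ] := Wgen 1.
  have /Jindep det0 : J (cmp u (\det C)).
    have -> : cmp u (\det C) = cmp u (\det C) * (1 - (map_mx (cmp u) G *m W) 0 0)
      + (cu _ _ G *m (cu _ _ (\adj C) *m (cu _ _ C *m W))) 0 0.
      have -> : cu _ _ (\adj C) *m (cu _ _ C *m W) = cmp u (\det C) *: W.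
        by rewrite mulmxA -map_mxM mul_adj_mx map_scalar_mx mul_scalar_mx.
      rewrite -scalemxAr [X in _ + X]mxE.
      by rewrite mulrBr mulr1 subrK.
    by apply: JD; [apply: JM|apply: (JXM _ _ (cu _ _ G)); apply: JXM].
  have := congr1 (meval b) det0; rewrite meval0 -det_map_mx.
  by rewrite -/(ev _ _ C) C1 det1 => /eqP; rewrite oner_eq0.
(* [V] is the dual of the fibre: the functionals that kill all relations. *)
pose V := kermx B^T.
have V0 : V != 0.
  rewrite -mxrank_eq0 mxrank_ker mxrank_tr subn_eq0 -ltnNge ltn_neqAle Bfull.
  exact: rank_leq_row.
have perp v x : (v <= V)%MS -> K x -> v *m x^T = 0 :> 'M_(1, 1).
  move=> /sub_kermxP vB /BK /submxP[y ->].
  by rewrite trmx_mul mulmxA vB mul0mx.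
have perpM k v (A : 'M[{mpoly F[m]}]_(k, r)) : (v <= V)%MS ->
    JX k (cu _ _ A *m W) -> v *m (ev _ _ A)^T = 0 :> 'M_(1, k).
  move=> vV AJ; apply/rowP => i; rewrite [RHS]mxE.
  have Kr : K (ev _ _ (row i A)).
    exists (row i A) => // i'; move: (AJ i); congr (J _).
    by rewrite !mxE; apply: eq_bigr => e _; rewrite !mxE.
  have /matrixP/(_ 0 0) := perp _ _ vV Kr.
  rewrite [RHS]mxE => <-.
  by rewrite !mxE; apply: eq_bigr => e _; rewrite !mxE.
have perpMV k l (v : 'M_(l, r)) (A : 'M[{mpoly F[m]}]_(k, r)) : (v <= V)%MS ->
    JX k (cu _ _ A *m W) -> v *m (ev _ _ A)^T = 0.
  move=> vV AJ; apply/row_matrixP => i; rewrite row_mul row0.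
  by apply: perpM => //; apply: submx_trans (row_sub _ _) vV.
have JcuM k (c : 'M_(k, r)) j : JX k (cu _ _ c *m W) -> JX k (cu _ _ (c *m M j) *m W).
  move=> cJ; have -> : cu _ _ (c *m M j) *m W = 'X_j *: (cu _ _ c *m W)
     - cu _ _ c *m ('X_j *: W - cu _ _ (M j) *m W).
    by rewrite mulmxBr scalemxAr subKr /cu map_mxM mulmxA.
  by apply: JXB; [rewrite -mul_scalar_mx|]; apply: JXM.
(* Relations are stable under the [M j], so the transposes preserve [V]; the commutators of the
   [M j] are relations, so the transposes commute on [V]. *)
have [||v v0 [vV vM]] := @common_eigenvector_on r V [seq (ev _ _ (M j))^T | j <- enum 'I_N] V0.
- move=> _ /mapP[j _ ->]; apply/sub_kermxP.
  rewrite -mulmxA -trmx_mul.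
  have [c [cJ ->]] : exists c : 'M_r, JX r (cu _ _ c *m W) /\ B = ev _ _ c.
    have /choice[c cE] : forall i, exists c : 'rV_r,
        JX 1%N (cu _ _ c *m W) /\ row i B = ev _ _ c.
      by move=> i; have /BK[c h1 h2] := row_sub i B; exists c.
    exists (\matrix_i c i); split.
      move=> i; have [+ _] := cE i => /(_ 0); congr (J _).
      by rewrite !mxE; apply: eq_bigr => e _; rewrite !mxE.
    by apply/row_matrixP => i; have [_ ->] := cE i; apply/rowP => e; rewrite !mxE.
  rewrite /ev -map_mxM; exact: (perpMV _ _ _ _ (submx_refl V) (JcuM _ _ _ cJ)).
- move=> _ _ /mapP[j _ ->] /mapP[l _ ->].
  apply/eqP; rewrite -subr_eq0 -mulmxBr -!trmx_mul -raddfB /= /ev -!map_mxM -map_mxB.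
  apply/eqP; apply: (perpMV _ _ _ _ (submx_refl V)).
  rewrite /cu map_mxB mulmxBl !map_mxM -!/(cu _ _ _).
  have E x y : cu _ _ (M x) *m cu _ _ (M y) *m W = ('X_y * 'X_x) *: W -
      (cu _ _ (M x) *m ('X_y *: W - cu _ _ (M y) *m W) +
       'X_y *: ('X_x *: W - cu _ _ (M x) *m W)).
    rewrite mulmxBr scalerBr scalerA -scalemxAr mulmxA.
    by rewrite [X in _ - X]addrC subrKA subKr.
  rewrite (E l j) (E j l) ['X_l * 'X_j]mulrC opprB addrC subrKA.
  have JE x y : JX r (cu _ _ (M x) *m ('X_y *: W - cu _ _ (M y) *m W) +
       'X_y *: ('X_x *: W - cu _ _ (M x) *m W)).
    apply: JXD; first exact: (JXM _ _ _ _ (ME y)).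
    by rewrite -mul_scalar_mx; exact: (JXM _ _ _ _ (ME x)).
  exact: (JXB _ _ _ (JE _ _) (JE _ _)).
have /choice[xi xiE] : forall j, exists a, v *m (ev _ _ (M j))^T = a *: v.
  by move=> j; apply: vM; apply: map_f; rewrite mem_enum.
(* Every [f] acts on the generators through some matrix for which [v] is an eigenvector with
   eigenvalue f(xi). *)
have Q f : exists A : 'M[{mpoly F[m]}]_r,
    JX r (f *: W - cu _ _ A *m W) /\ v *m (ev _ _ A)^T = f.@[xi] *: v.
  have QD f1 f2 A1 A2 :
     JX r (f1 *: W - cu _ _ A1 *m W) -> v *m (ev _ _ A1)^T = f1.@[xi] *: v ->
     JX r (f2 *: W - cu _ _ A2 *m W) -> v *m (ev _ _ A2)^T = f2.@[xi] *: v ->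
     JX r ((f1 * f2) *: W - cu _ _ (A2 *m A1) *m W) /\
     v *m (ev _ _ (A2 *m A1))^T = (f1 * f2).@[xi] *: v.
    move=> h1 e1 h2 e2; split; last first.
      by rewrite /ev map_mxM trmx_mul mulmxA e1 -scalemxAl e2 scalerA mevalM.
    have -> : (f1 * f2) *: W - cu _ _ (A2 *m A1) *m W =
        f1 *: (f2 *: W - cu _ _ A2 *m W) + cu _ _ A2 *m (f1 *: W - cu _ _ A1 *m W).
      rewrite /cu map_mxM -/(cu _ _ A2) -/(cu _ _ A1) mulmxBr scalerBr scalerA -scalemxAr mulmxA.
      by rewrite addrA subrK.
    apply: JXD; last exact: (JXM _ _ _ _ h1).
    by rewrite -mul_scalar_mx; exact: (JXM _ _ _ _ h2).
  have Q1 : JX r (1 *: W - cu _ _ 1%:M *m W) /\ v *m (ev _ _ 1%:M)^T = (1 : {mpoly F[N]}).@[xi] *: v.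
    rewrite /cu /ev !map_mx1 mul1mx trmx1 mulmx1 meval1 !scale1r subrr.
    by split => // i; rewrite mxE.
  elim/mpolyind: f => [|c m' f _ _ [A [AJ Av]]].
    exists 0; rewrite /cu /ev !map_mx0 mul0mx trmx0 mulmx0 meval0 !scale0r subr0.
    by split => // i; rewrite mxE.
  have [A' [A'J A'v]] : exists A' : 'M[{mpoly F[m]}]_r,
      JX r ('X_[m'] *: W - cu _ _ A' *m W) /\ v *m (ev _ _ A')^T = ('X_[m']).@[xi] *: v.
    rewrite mpolyXE_id; apply: (big_ind (fun f : {mpoly F[N]} => exists A',
        JX r (f *: W - cu _ _ A' *m W) /\ v *m (ev _ _ A')^T = f.@[xi] *: v)).
    + by exists 1%:M.
    + by move=> f1 f2 [A1 [h1 e1]] [A2 [h2 e2]]; exists (A2 *m A1); exact: (QD _ _ _ _ h1 e1 h2 e2).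
    + move=> j _; elim: (m' j) => [|e [A1 [h1 e1]]]; first by exists 1%:M.
      exists (A1 *m M j); rewrite exprS; apply: (QD _ _ _ _ (ME j) _ h1 e1).
      by rewrite mevalXU.
  exists (c%:MP *: A' + A); split; last first.
    rewrite /ev map_mxD map_mxZ /= mevalC raddfD /= linearZ /= mulmxDr -scalemxAr.
    by rewrite A'v Av mevalD mevalZ scalerA scalerDl.
  have -> : (c *: 'X_[m'] + f) *: W - cu _ _ (c%:MP *: A' + A) *m W =
      c%:MP *: ('X_[m'] *: W - cu _ _ A' *m W) + (f *: W - cu _ _ A *m W).
    rewrite /cu map_mxD map_mxZ /= comp_mpolyC mulmxDl -scalemxAl.
    by rewrite scalerDl -mul_mpolyC opprD addrACA scalerBr scalerA.
  apply: JXD; last exact: AJ.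
  by rewrite -mul_scalar_mx; exact: (JXM _ _ _ _ A'J).
have scal_v x y : x *: v = y *: v -> x = y.
  move=> /eqP; rewrite -subr_eq0 -scalerBl scaler_eq0 (negPf v0) orbF subr_eq0.
  by move=> /eqP.
exists xi; split=> [f Jf|s].
  have [A [AJ Av]] := Q f; apply: scal_v; rewrite scale0r -Av.
  apply: (perpMV _ _ _ _ vV); rewrite -[_ *m W](subKr (f *: W)).
  apply: JXB; last exact: AJ.
  by move=> i; rewrite mxE mulrC; apply: JM.
have [A [AJ Av]] := Q (u s); apply: scal_v; rewrite -Av.
apply/eqP; rewrite -subr_eq0; apply/eqP.
(* Multiplication by [u s] is also given by the scalar matrix X_s, which has the value [b s] at [b];
   the difference of the two matrices is a relation. *)
have -> : v *m (ev _ _ A)^T - b s *: v = v *m (ev _ _ (A - ('X_s)%:M))^T.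
  by rewrite /ev map_mxB raddfB /= mulmxBr map_scalar_mx tr_scalar_mx mul_mx_scalar /= mevalXU.
apply: (perpMV _ _ _ _ vV); rewrite /cu map_mxB map_scalar_mx mulmxBl mul_scalar_mx.
rewrite /= comp_mpolyXU -tnth_nth tnth_mktuple => i.
by rewrite -opprB mxE -mulN1r; apply: JM.
Qed.

Lemma lying_over (N m T : nat) (J : set {mpoly F[N]}) (u : 'I_m -> {mpoly F[N]}) :
  ideal J -> finite_over J u T -> (forall G, J (cmp u G) -> G = 0) ->
  forall b : 'I_m -> F, exists xi : 'I_N -> F,
    (forall f, J f -> f.@[xi] = 0) /\ (forall s, (u s).@[xi] = b s).
Proof.
move=> Ji fin; have [J0 JD JM] := Ji.
(* The module generators are the monomials with all exponents at most [T]. *)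
pose A := {ffun 'I_N -> 'I_T.+1}.
pose W : 'cV[{mpoly F[N]}]_#|A| :=
  \col_a 'X_[[multinom (enum_val a : A) i : nat | i < N]].
apply: (@lying_over_module _ _ _ _ _ W) => //.
pose P (t : nat) f := exists G : 'rV[{mpoly F[m]}]_#|A|, J (f - (map_mx (cmp u) G *m W) 0 0).
have PD t f g : P t f -> P t g -> P t (f + g).
  move=> [G GJ] [H HJ]; exists (G + H).
  have -> : f + g - (map_mx (cmp u) (G + H) *m W) 0 0 =
    (f - (map_mx (cmp u) G *m W) 0 0) + (g - (map_mx (cmp u) H *m W) 0 0).
    have -> : map_mx (cmp u) (G + H) = map_mx (cmp u) G + map_mx (cmp u) H.
      by apply/matrixP => i j; rewrite !mxE /cmp comp_mpolyD.
    by rewrite mulmxDl [X in _ - X]mxE opprD addrACA.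
  exact: JD.
have PM t h f : P t f -> P t (cmp u h * f).
  move=> [G GJ]; exists (h *: G).
  have -> : cmp u h * f - (map_mx (cmp u) (h *: G) *m W) 0 0 =
    cmp u h * (f - (map_mx (cmp u) G *m W) 0 0).
    have -> : map_mx (cmp u) (h *: G) = cmp u h *: map_mx (cmp u) G.
      by apply/matrixP => i j; rewrite !mxE /cmp rmorphM.
    by rewrite -scalemxAl mxE mulrBr.
  exact: JM.
have P0 t : P t 0.
  exists 0; rewrite (_ : map_mx _ _ = 0) ?mul0mx ?mxE ?subr0//.
  by apply/matrixP => i j; rewrite !mxE /cmp comp_mpoly0.
have Ph : forall t f, f \is t.-homog -> P t f.
  apply: (finite_over_ind Ji fin) => //.
  - move=> t c f Pf; rewrite -mul_mpolyC -(comp_mpolyC c [tuple u s | s < m]).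
    exact: PM.
  - move=> t f g fg [G GJ]; exists G.
    by rewrite -[f](subrK g) -addrA; apply: JD.
  - move=> t s f Pf; suff : P t (u s * f) by [].
    have -> : u s = cmp u 'X_s by rewrite /cmp comp_mpolyXU -tnth_nth tnth_mktuple.
    exact: PM.
  - move=> m' m'T; pose a : A := [ffun i => Ordinal (m'T i)].
    exists (delta_mx 0 (enum_rank a)).
    have -> : map_mx (cmp u) (delta_mx 0 (enum_rank a) : 'rV_#|A|) =
        delta_mx 0 (enum_rank a) :> 'rV_#|A|.
      by apply/matrixP => i j; rewrite !mxE /cmp rmorph_nat.
    rewrite -rowE !mxE enum_rankK (_ : [multinom _ | i < N] = m') ?subrr//.
    by apply/mnmP => i; rewrite mnmE ffunE.
move=> f; rewrite (pihomog_partitionE (leqnn (msize f))).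
apply: (big_ind (P 0%N)) => // [g h|d _]; first exact: PD.
exact: (Ph d _ (pihomogP _ _ _)).
Qed.

End LyingOver.

(** * Projective points and cones *)

Section Cones.
Context (F : numClosedFieldType) (n : nat).
Implicit Types (X Y Z : set (point F n)) (p q : point F n) (f : {mpoly F[n.+1]}).

Definition cone X (x : 'cV[F]_n.+1) : Prop := exists2 p, X p & coords p x.

Definition cone_pt X (w : {x | cone X x}) : 'I_n.+1 -> F := fun j => sval w j 0.

Lemma coords_ex p : exists x, coords p x.
Proof.
exists (vpick (val p)); split; last exact: memv_pick.
by rewrite vpick0 -dimv_eq0 (eqP (valP p)).
Qed.

Lemma coords_line p x : coords p x -> val p = <[x]>%VS.
Proof.
move=> [x0 xp]; apply/esym/eqP; rewrite eqEdim -memvE xp /=.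
by rewrite (eqP (valP p)) dim_vline x0.
Qed.

Lemma coordsZ p x t : t != 0 -> coords p x -> coords p (t *: x).
Proof. by move=> t0 [x0 xp]; split; [rewrite scaler_eq0 negb_or t0|apply: memvZ]. Qed.

Lemma coords_proportional p x y : coords p x -> coords p y ->
  exists2 t, t != 0 & y = t *: x.
Proof.
move=> px [y0]; rewrite (coords_line px) => /vlineP[t yE]; exists t => //.
by apply: contra y0 => /eqP t0; rewrite yE t0 scale0r.
Qed.

Lemma point_of (x : 'cV[F]_n.+1) : x != 0 -> exists p, coords p x.
Proof.
move=> x0; have d1 : \dim <[x]>%VS == 1%N by rewrite dim_vline x0.
by exists (exist _ <[x]>%VS d1); split => //=; apply: memv_line.
Qed.

Lemma cone_conic X : conic (@cone_pt X).
Proof.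
move=> [x [p Xp px]] t t0; have tx : cone X (t *: x) by exists p => //; apply: coordsZ.
by exists (exist _ _ tx) => i; rewrite /cone_pt /= mxE.
Qed.

Lemma cone_neq0 X w : exists i, @cone_pt X w i != 0.
Proof.
case: w => x [p Xp [x0 px]]; apply: contrapT => /forallNP h; apply: (negP x0); apply/eqP/colP => i.
by rewrite [RHS]mxE; apply/eqP/negPn/negP; apply: h.
Qed.

Lemma cone_inhabited X : X !=set0 -> inhabited {x | cone X x}.
Proof.
by move=> [p Xp]; have [x px] := coords_ex p; constructor; exists x; exists p.
Qed.

Lemma vanishing_cone X f :
  vanishing (@cone_pt X) f <-> forall p, X p -> vanishes f p.
Proof.
split=> [f0 p Xp x px|f0 [x [p Xp px]]]; last exact: (f0 p Xp x px).
by apply: (f0 (exist _ x _)); exists p.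
Qed.

Lemma vanishes_homog f d p x : f \is d.-homog -> coords p x ->
  f.@[fun j => x j 0] = 0 -> vanishes f p.
Proof.
move=> fd px fx y /(coords_proportional px)[t _ ->].
rewrite (meval_eq (v2 := fun j => t * x j 0)).
  by rewrite (meval_scale _ _ fd) fx mulr0.
by move=> j; rewrite mxE.
Qed.

(** Equations need not be homogeneous: with a polynomial, its homogeneous components vanish on the
    cone too. *)
Lemma zariski_closedP Z : zariski_closed Z <->
  forall p, (forall f, (forall q, Z q -> vanishes f q) -> vanishes f p) -> Z p.
Proof.
split=> [[S [_ ->]] p h f Sf|h]; first by apply: h => q /(_ f Sf).
exists [set f | (exists d, f \is d.-homog) /\ forall q, Z q -> vanishes f q].
split=> [f []//|]; apply/seteqP; split=> [p Zp f [_ /(_ p Zp)]//|p pP].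
apply: h => f fZ x px; rewrite (pihomog_partitionE (leqnn (msize f))).
rewrite raddf_sum big1// => d _.
have : vanishes (pihomog mdeg d f) p; last exact.
apply: pP; split; first by exists d; apply: pihomogP.
by apply/vanishing_cone/vanishing_pihomog; [apply: cone_conic|apply/vanishing_cone].
Qed.

Lemma zariski_closed_vanishes f : zariski_closed [set p | vanishes f p].
Proof. by apply/zariski_closedP => p; apply. Qed.

Lemma zariski_closed_bigcap (A : set (set (point F n))) :
  (forall Z, A Z -> zariski_closed Z) ->
  zariski_closed [set p | forall Z, A Z -> Z p].
Proof.
move=> Acl; apply/zariski_closedP => p h Z AZ.
have /zariski_closedP := Acl Z AZ; apply => f fZ; apply: h => q.
by move=> /(_ Z AZ); apply: fZ.
Qed.

Lemma zariski_closedI X Y : zariski_closed X -> zariski_closed Y ->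
  zariski_closed (X `&` Y).
Proof.
move=> /zariski_closedP Xc /zariski_closedP Yc; apply/zariski_closedP => p h.
by split; [apply: Xc|apply: Yc] => f fX; apply: h => q []; auto.
Qed.

Lemma zariski_closure_closed X : zariski_closed (zariski_closure X).
Proof.
apply/zariski_closedP => p h Z Zc XZ.
have /zariski_closedP := Zc; apply => f fZ; apply: h => q.
by move=> /(_ Z Zc XZ); apply: fZ.
Qed.

Lemma sub_zariski_closure X : X `<=` zariski_closure X.
Proof. by move=> p Xp Z _ ; apply. Qed.

Lemma finite_over_sub (m T : nat) X Y (u : 'I_m -> {mpoly F[n.+1]}) :
  Y `<=` X -> finite_over (vanishing (@cone_pt X)) u T ->
  finite_over (vanishing (@cone_pt Y)) u T.
Proof.
move=> YX fin j; have [q [qh qX]] := fin j; exists q; split => //.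
apply/vanishing_cone => p /YX; exact: (vanishing_cone _ _).1.
Qed.

Lemma point_at (xi : 'I_n.+1 -> F) (u : {mpoly F[n.+1]}) :
  u \is 1.-homog -> u.@[xi] != 0 ->
  exists p (x : 'cV[F]_n.+1), coords p x /\ (fun j => x j 0) =1 xi.
Proof.
move=> u1 uxi; pose x : 'cV[F]_n.+1 := \col_j xi j.
have xE : (fun j => x j 0) =1 xi by move=> j; rewrite mxE.
have x0 : x != 0.
  apply: contra uxi => /eqP x0; rewrite (meval_eq (v2 := fun j => 0 * xi j)).
    by rewrite (meval_scale _ _ u1) expr1 mul0r.
  by move=> j; rewrite -xE x0 mxE mul0r.
by have [p px] := point_of x0; exists p, x.
Qed.

Lemma zariski_closed_coords Z p x : zariski_closed Z -> coords p x ->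
  (forall f, vanishing (@cone_pt Z) f -> f.@[fun j => x j 0] = 0) -> Z p.
Proof.
move=> /zariski_closedP Zc px h; apply: Zc => f fZ y py.
rewrite (pihomog_partitionE (leqnn (msize f))).
rewrite raddf_sum big1// => d _; apply: (vanishes_homog _ px) => //=.
  exact: pihomogP.
by apply: h; apply: vanishing_pihomog; [apply: cone_conic|apply/vanishing_cone].
Qed.

(** A non-zero [b] keeps the affine solution away from the origin, so that it represents a
    projective point. *)
Lemma cone_lying_over (m T : nat) X (u : 'I_m -> {mpoly F[n.+1]}) :
  zariski_closed X -> finite_over (vanishing (@cone_pt X)) u T ->
  alg_indep (@cone_pt X) u -> (forall s, u s \is 1.-homog) ->
  forall b : 'I_m -> F, (exists s, b s != 0) ->
  exists w : {x | cone X x}, forall s, (u s).@[cone_pt w] = b s.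
Proof.
move=> Xc fin ind u1 b [s bs].
have [G Gv|xi [xiX xib]] := lying_over (vanishing_ideal _) fin _ b.
  by apply: ind => w; rewrite -cmp_meval; apply: Gv.
rewrite -xib in bs; have [p [x [px xE]]] := point_at (u1 s) bs.
have Xx : cone X x.
  exists p => //; apply: (zariski_closed_coords Xc px) => f fX.
  by rewrite (meval_eq _ xE); apply: xiX.
by exists (exist _ x Xx) => s'; rewrite -xib; apply: meval_eq.
Qed.

Lemma minimal_integral (m T : nat) X (u : 'I_m -> {mpoly F[n.+1]}) :
  zariski_closed X -> finite_over (vanishing (@cone_pt X)) u T ->
  alg_indep (@cone_pt X) u -> (forall s, u s \is 1.-homog) ->
  (0 < m)%N ->
  exists Z, [/\ integral_variety Z, Z `<=` X & alg_indep (@cone_pt Z) u].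
Proof.
move=> Xc fin ind u1 m0.
pose S := {Z | [/\ zariski_closed Z, Z `<=` X & alg_indep (@cone_pt Z) u]}.
pose R (Z1 Z2 : S) := `[< sval Z2 `<=` sval Z1 >].
have [t|r s t /asboolP rs /asboolP st|[s sP] [t tP] /asboolP /= st /asboolP /= ts|A Atot|] :=
    @Zorn S R.
- by apply/asboolP.
- by apply/asboolP; apply: subset_trans st rs.
- by have e : s = t by [apply/seteqP]; subst t; congr exist; apply: Prop_irrelevance.
- have [[Z0 AZ0]|A0] := pselect (A !=set0); last first.
    have XS : [/\ zariski_closed X, X `<=` X & alg_indep (@cone_pt X) u] by split.
    by exists (exist _ X XS) => s As; case: A0; exists s.
  pose Z := [set p | forall Z, (exists2 s, A s & sval s = Z) -> Z p].
  have Zc : zariski_closed Z.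
    by apply: zariski_closed_bigcap => _ [s _ <-]; case: (svalP s).
  have ZS s : A s -> Z `<=` sval s by move=> As p; apply; exists s.
  have ZX : Z `<=` X by apply: subset_trans (ZS _ AZ0) _; case: (svalP Z0).
  suff Zi : alg_indep (@cone_pt Z) u.
    have ZP : [/\ zariski_closed Z, Z `<=` X & alg_indep (@cone_pt Z) u] by split.
    by exists (exist _ Z ZP) => s As; apply/asboolP => /=; apply: ZS.
  (* The union of the vanishing ideals along the chain is an ideal modulo which [u] is finite and
     independent; its zeros lie in every member of the chain. *)
  pose J := [set f | exists2 s, A s & vanishing (@cone_pt (sval s)) f].
  have Jmono (s t : S) f : A s -> sval t `<=` sval s -> vanishing (@cone_pt (sval s)) f ->
      vanishing (@cone_pt (sval t)) f.
    by move=> As ts /vanishing_cone fs; apply/vanishing_cone => p /ts; apply: fs.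
  have Ji : ideal J.
    split; first by exists Z0 => //; case: (vanishing_ideal (@cone_pt (sval Z0))).
    - move=> f g [s As fs] [t At gt].
      have [/asboolP st|/asboolP ts] := Atot s t As At.
        exists t => //; have [_ JD _] := vanishing_ideal (@cone_pt (sval t)).
        exact: (JD _ _ (Jmono s t f As st fs) gt).
      exists s => //; have [_ JD _] := vanishing_ideal (@cone_pt (sval s)).
      exact: (JD _ _ fs (Jmono t s g At ts gt)).
    - move=> f g [s As gs]; exists s => //.
      by have [_ _ JM] := vanishing_ideal (@cone_pt (sval s)); apply: JM.
  have finJ : finite_over J u T.
    move=> j; have [_ Z0X _] := svalP Z0; have [q [qh qZ]] := finite_over_sub Z0X fin j.
    by exists q; split => //; exists Z0.
  have indJ G : J (cmp u G) -> G = 0.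
    move=> [s _ Gs]; have [_ _] := svalP s; apply => w.
    by rewrite -cmp_meval; apply: Gs.
  move=> G Gv; apply/eqP/negPn/negP => G0.
  (* The additional variable keeps one coordinate of [b] non-zero, so that the point above [b] is
     projective; [m] must be positive for this. *)
  have /mpoly_nonroot[b] : G * 'X_(Ordinal m0) != 0.
    by rewrite mulf_neq0// -msize_poly_eq0 msizeX mdeg1.
  rewrite mevalM mevalXU mulf_eq0 negb_or => /andP[/eqP Gb b0]; apply: Gb.
  have [xi [xiJ xib]] := lying_over Ji finJ indJ b.
  rewrite -xib in b0; have [p [x [px xE]]] := point_at (u1 _) b0.
  have Zx : cone Z x.
    exists p => // _ [s As <-]; have [sc _ _] := svalP s.
    apply: (zariski_closed_coords sc px) => f fs.
    by rewrite (meval_eq _ xE); apply: xiJ; exists s.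
  have := Gv (exist _ x Zx); rewrite (meval_eq (v2 := b))// => s.
  by rewrite -xib; apply: meval_eq.
move=> [Z [Zc ZX Zi]] /= Zmin; exists Z; split => //; split => //; split.
  apply: contrapT => Z0; have /eqP : (1 : {mpoly F[m]}) = 0.
    by apply: (Zi) => -[x [p Zp px]]; case: Z0; exists p.
  by rewrite oner_eq0.
move=> Z1 Z2 Z1c Z2c Z12.
(* By minimality [u] satisfies a relation on the trace of any closed set that does not contain [Z].
   If two such sets covered [Z], the product of their relations would hold on [Z]. *)
have key Z' : zariski_closed Z' -> ~ Z `<=` Z' ->
    exists2 G : {mpoly F[m]}, G != 0 &
      forall p, Z p -> Z' p -> vanishes (cmp u G) p.
  move=> Z'c ZZ'; have : ~ alg_indep (@cone_pt (Z `&` Z')) u.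
    move=> ind'; have P' : [/\ zariski_closed (Z `&` Z'), Z `&` Z' `<=` X &
        alg_indep (@cone_pt (Z `&` Z')) u].
      by split => //; [apply: zariski_closedI|move=> p [/ZX]].
    have /(congr1 sval)/= e : exist _ _ P' = _ := Zmin (exist _ _ P') (asboolT (@subIsetl _ _ _)).
    by apply: ZZ'; rewrite -e => p [].
  move=> /existsNP[G /not_implyP[Gv /eqP G0]]; exists G => // p Zp Z'p.
  apply: (vanishing_cone (Z `&` Z') _).1 => // w.
  by rewrite cmp_meval; apply: Gv.
apply: contrapT => /not_orP[/(key _ Z1c)[G1 G10 G1v] /(key _ Z2c)[G2 G20 G2v]].
have : G1 * G2 != 0 by rewrite mulf_neq0.
move/eqP; apply; apply: (Zi) => -[x [p Zp px]].
rewrite mevalM; apply/eqP; rewrite mulf_eq0 -!cmp_meval.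
by case: (Z12 p Zp) => Zip; apply/orP; [left|right]; apply/eqP; [apply: (G1v p)|apply: (G2v p)].
Qed.

End Cones.

(** * Chains of integral varieties *)

Section Chains.
Context (F : numClosedFieldType) (n : nat).
Implicit Types (X Y Z : set (point F n)) (p q : point F n) (f g : {mpoly F[n.+1]}).

Lemma has_chain_sub X Y m : X `<=` Y -> has_chain X m -> has_chain Y m.
Proof.
move=> XY [Z [Zi Zlt]]; exists Z; split => // i /Zi[? ZX]; split => //.
exact: subset_trans XY.
Qed.

Lemma has_chain_le X m m' : (m' <= m)%N -> has_chain X m -> has_chain X m'.
Proof.
move=> mm' [Z [Zi Zlt]]; exists Z; split=> i im.
  by apply: Zi; apply: leq_trans mm'.
by apply: Zlt; apply: leq_trans mm'.
Qed.

Lemma has_chainS X Y m : integral_variety X -> Y `<` X -> has_chain Y m ->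
  has_chain X m.+1.
Proof.
move=> Xi [YX XY] [Z [Zi Zlt]].
exists (fun i => if (i <= m)%N then Z i else X); split=> i im.
  by case: ifPn => [/Zi[? ZY]|_]; split => //; apply: subset_trans YX.
rewrite -ltnS im; case: ltnP => [|mi]; first exact: Zlt.
have -> : i = m by apply/eqP; rewrite eqn_leq -ltnS im.
have [_ ZY] := Zi m (leqnn m).
split; first exact: subset_trans YX.
by move=> XZ; apply: XY; apply: subset_trans ZY.
Qed.

(** Lying over vectors with last entry zero yields points of the section at which the remaining
    forms take prescribed values. *)
Lemma hyperplane_section (m T : nat) X (u : 'I_m.+2 -> {mpoly F[n.+1]}) :
  zariski_closed X -> finite_over (vanishing (@cone_pt _ _ X)) u T ->
  alg_indep (@cone_pt _ _ X) u -> (forall s, u s \is 1.-homog) ->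
  let Y := X `&` [set p | vanishes (u ord_max) p] in
  let u' := fun s : 'I_m.+1 => u (widen_ord (leqnSn _) s) in
  [/\ zariski_closed Y, finite_over (vanishing (@cone_pt _ _ Y)) u' T
    & alg_indep (@cone_pt _ _ Y) u'].
Proof.
move=> Xc fin ind u1 Y u'; split.
- by apply: zariski_closedI => //; apply: zariski_closed_vanishes.
- move=> j; have YX : Y `<=` X by move=> p [].
  have [q [qh qY]] := finite_over_sub YX fin j.
  exists (fun s => q (widen_ord (leqnSn _) s)); split => // -[x [p Yp px]].
  have := qY (exist _ x (ex_intro2 _ _ p Yp px)).
  rewrite big_ord_recr /= opprD addrA mevalB mevalM.
  by have [_ /(_ x px)] := Yp; rewrite /cone_pt /= => ->; rewrite mul0r subr0.
- move=> G Gv; apply/eqP/negPn/negP => G0.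
  have /mpoly_nonroot[b] : G * 'X_0 != 0.
    by rewrite mulf_neq0// -msize_poly_eq0 msizeX mdeg1.
  rewrite mevalM mevalXU mulf_eq0 negb_or => /andP[/eqP Gb b0]; apply: Gb.
  pose b' (s : 'I_m.+2) := if unlift ord_max s is Some s' then b s' else 0.
  have b'w s : b' (widen_ord (leqnSn _) s) = b s.
    rewrite /b'; case: unliftP => [s' /(congr1 val)/=|/(congr1 val)/= e].
      by rewrite /bump leqNgt ltn_ord => e; congr b; apply/val_inj.
    by have := ltn_ord s; rewrite e ltnn.
  have [|[x Xx] wb] := cone_lying_over Xc fin ind u1 (b := b').
    by exists (widen_ord (leqnSn _) 0); rewrite b'w.
  have Yx : cone Y x.
    have [p Xp px] := Xx; exists p => //; split => //=.
    by apply: (vanishes_homog (u1 _) px); rewrite -/(cone_pt (exist _ x Xx)) wb /b' unlift_none.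
  rewrite -(Gv (exist _ x Yx)); apply: meval_eq => s.
  by rewrite -b'w -wb.
Qed.

Lemma finite_over_chain (m T : nat) X (u : 'I_m.+1 -> {mpoly F[n.+1]}) :
  zariski_closed X -> finite_over (vanishing (@cone_pt _ _ X)) u T ->
  alg_indep (@cone_pt _ _ X) u -> (forall s, u s \is 1.-homog) ->
  has_chain X m.
Proof.
elim: m X u => [|m IH] X u Xc fin ind u1;
    have [//|Z [Zi ZX Zind]] := minimal_integral Xc fin ind u1.
  by exists (fun=> Z); split.
apply: (has_chain_sub ZX).
have [Yc Yfin Yind] := hyperplane_section Zi.1 (finite_over_sub ZX fin) Zind u1.
apply: has_chainS Zi _ (IH _ _ Yc Yfin Yind _) => //.
split=> [p []//|Zu].
(* If the section were all of [Z], the last variable would be a relation between the forms. *)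
have /eqP : 'X_ord_max = 0 :> {mpoly F[m.+2]}.
  by apply: Zind => -[x [p Zp px]]; rewrite mevalXU; have [_] := Zu p Zp; apply.
by rewrite -msize_poly_eq0 msizeX mdeg1.
Qed.

(** Homogeneity of [f] spreads its vanishing from one representative to the whole line; at a point
    where [f] does not vanish, [g] must therefore vanish on every representative. *)
Lemma irreducible_prime X e f g : irreducible X -> f \is e.-homog ->
  vanishing (@cone_pt _ _ X) (f * g) ->
  vanishing (@cone_pt _ _ X) f \/ vanishing (@cone_pt _ _ X) g.
Proof.
move=> [_ Xi] fe fg.
have [p Xp|Xf|Xg] := Xi _ _ (zariski_closed_vanishes f) (zariski_closed_vanishes g).
- have [fp|/existsNP[x /not_implyP[px fx]]] := pselect (vanishes f p); first by left.
  right=> y py; have := fg (exist _ y (ex_intro2 _ _ p Xp py)).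
  rewrite mevalM /cone_pt /= => /eqP; rewrite mulf_eq0 => /orP[/eqP fy|/eqP//].
  by case: fx; apply: (vanishes_homog fe py fy).
- by left; apply/vanishing_cone.
- by right; apply/vanishing_cone.
Qed.

Lemma msizeM_bound (N a b : nat) (f g : {mpoly F[N]}) :
  (msize f <= a.+1)%N -> (msize g <= b.+1)%N -> (msize (f * g) <= (a + b).+1)%N.
Proof.
have [->|f0] := eqVneq f 0; first by rewrite mul0r msize0.
have [->|g0] := eqVneq g 0; first by rewrite mulr0 msize0.
move=> fa gb; rewrite msizeM//.
by move: (msize f) (msize g) fa gb => x y; lia.
Qed.

Lemma msize_exp_bound (N a e : nat) (f : {mpoly F[N]}) :
  (msize f <= a.+1)%N -> (msize (f ^+ e) <= (e * a).+1)%N.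
Proof.
move=> fa; elim: e => [|e IH]; first by rewrite expr0 mul0n msizeC oner_eq0.
by rewrite exprS mulSn; apply: msizeM_bound.
Qed.

(** A relation is an expansion in powers of [g]: cancelling the lowest power on [X] and restricting
    to [Z], where [g] vanishes, isolates the lowest coefficient. *)
Lemma indep_on_powers X Z e g s (I : finType) (phi : I -> {mpoly F[n.+1]}) :
  irreducible X -> g \is e.-homog -> vanishing (@cone_pt _ _ Z) g ->
  ~ vanishing (@cone_pt _ _ X) g -> Z `<=` X ->
  indep_on (fun i w => (phi i).@[@cone_pt _ _ Z w]) ->
  indep_on (fun (ai : 'I_s * I) w => (g ^+ ai.1 * phi ai.2).@[@cone_pt _ _ X w]).
Proof.
move=> Xi ge gZ gX ZX ind c cX.
suff H a i (ha : (a < s)%N) : c (Ordinal ha, i) = 0.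
  by move=> [[a ha] i]; apply: H.
elim/ltn_ind: a i ha => a IH i ha.
(* [Q] is the relation divided by [g ^+ a]; the terms below [a] are already zero by induction. *)
pose Q := \sum_(b < s) (if (a <= b)%N then g ^+ (b - a) * \sum_i c (b, i) *: phi i else 0).
have gQ : vanishing (@cone_pt _ _ X) (g ^+ a * Q).
  move=> w; rewrite -[RHS](cX w) mevalM /Q raddf_sum mulr_sumr /=.
  transitivity (\sum_(b < s) \sum_i c (b, i) * (g ^+ b * phi i).@[cone_pt w]); last first.
    by rewrite pair_bigA; apply: eq_bigr => -[].
  apply: eq_bigr => b _; case: leqP => ab; last first.
    rewrite meval0 mulr0 big1// => i' _.
    by rewrite (_ : b = Ordinal (ltn_ord b)) ?IH ?mul0r//; apply/val_inj.
  rewrite -mevalM mulrA -exprD subnKC// mulr_sumr raddf_sum /=; apply: eq_bigr => i' _.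
  by rewrite -scalerAr mevalZ.
have QX : vanishing (@cone_pt _ _ X) Q.
  elim: a {IH ha} Q gQ => [|a IHa] Q; first by rewrite expr0 mul1r.
  by rewrite exprS -mulrA => /(irreducible_prime Xi ge)[//|/IHa].
have QZ : vanishing (@cone_pt _ _ Z) Q.
  by apply/vanishing_cone => p /ZX; apply: (vanishing_cone _ _).1.
apply: (ind (fun i => c (Ordinal ha, i))) => w.
rewrite -[RHS](QZ w) /Q raddf_sum (bigD1 (Ordinal ha))//= leqnn subnn expr0 mul1r.
rewrite raddf_sum /= [X in _ + X]big1 ?addr0.
  by apply: eq_bigr => i' _; rewrite mevalZ.
move=> b /eqP ba; case: leqP => ab; last exact: meval0.
rewrite mevalM rmorphXn /= gZ expr0n subn_eq0 leqNgt.
suff -> : (a < b)%N by rewrite mul0r.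
by rewrite ltn_neqAle ab andbT; apply/eqP => e'; apply: ba; apply/val_inj.
Qed.

(** Each link of the chain contributes a factor [s.+1]: the powers up to [s] of a form that vanishes
    on the smaller variety but not on the larger one. *)
Lemma chain_family (Z : nat -> set (point F n)) m :
  (forall i, (i <= m)%N -> integral_variety (Z i)) ->
  (forall i, (i < m)%N -> Z i `<` Z i.+1) ->
  exists D : nat, forall s, exists (I : finType) (phi : I -> {mpoly F[n.+1]}),
    [/\ #|I| = (s.+1 ^ m.+1)%N, forall i, (msize (phi i) <= (D * s).+1)%N
      & indep_on (fun i w => (phi i).@[@cone_pt _ _ (Z m) w])].
Proof.
elim: m => [|m IH] Zi Zlt.
  have [_ [[p Zp] _]] := Zi 0%N (leqnn _); have [x px] := coords_ex p.
  pose w0 : {x | cone (Z 0%N) x} := exist _ x (ex_intro2 _ _ p Zp px).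
  have [j xj] := cone_neq0 w0.
  exists 1%N => s; exists 'I_s.+1, (fun a : 'I_s.+1 => 'X_j ^+ a); split.
  - by rewrite card_ord expn1.
  - move=> a; apply: leq_trans (msize_exp_bound (a := 1) a _) _.
      by rewrite msizeX mdeg1.
    by rewrite muln1 mul1n ltn_ord.
  (* Powers of one coordinate have different degrees, so each term of a relation vanishes separately
     on the cone. *)
  - move=> c cv a; have cv' : vanishing (@cone_pt _ _ (Z 0%N)) (\sum_b c b *: 'X_j ^+ b).
      by move=> w; rewrite -[RHS](cv w) raddf_sum; apply: eq_bigr => b _; rewrite /= mevalZ.
    have := vanishing_pihomog a (@cone_conic _ _ _) cv' w0.
    have E (b : 'I_s.+1) : pihomog mdeg a (c b *: 'X_j ^+ b) =
        (if b == a then c b *: 'X_j ^+ b else 0).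
      rewrite linearZ /= mpolyXn pihomogX /= mdegMn mdeg1 mul1n.
      by rewrite -[_ == _ :> nat]/(b == a); case: eqP; rewrite ?scaler0.
    have -> : pihomog mdeg a (\sum_b c b *: 'X_j ^+ b) =
        \sum_b (if b == a then c b *: 'X_j ^+ b else 0).
      by rewrite raddf_sum; apply: eq_bigr => b _; apply: E.
    rewrite -big_mkcond big_pred1_eq mevalZ rmorphXn /= mevalXU => /eqP.
    by rewrite mulf_eq0 expf_eq0 (negPf xj) andbF orbF => /eqP.
have [|i im|D Dm] := IH; first by move=> i im; apply: Zi; apply: leqW.
  by apply: Zlt; apply: leqW.
have [ZZ nZZ] := Zlt m (leqnn _).
have [[S [Sh ZE]] _] := Zi m (leqnSn m).
have [_ Zirr] := Zi m.+1 (leqnn _).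
have [g [e [ge gZ gZ1]]] : exists g e, [/\ g \is e.-homog,
    vanishing (@cone_pt _ _ (Z m)) g & ~ vanishing (@cone_pt _ _ (Z m.+1)) g].
  move: nZZ => /existsNP[p /not_implyP[Z1p]]; rewrite [in X in ~ X]ZE.
  move=> /existsNP[g /not_implyP[Sg gp]]; have [e ge] := Sh g Sg.
  exists g, e; split => //; last by move=> /vanishing_cone/(_ p Z1p).
  by apply/vanishing_cone => q; rewrite ZE => /(_ g Sg).
exists (msize g + D)%N => s; have [I [phi [cI phiD ind]]] := Dm s.
exists ('I_s.+1 * I)%type, (fun ai : 'I_s.+1 * I => g ^+ ai.1 * phi ai.2); split.
- by rewrite card_prod card_ord cI [RHS]expnS.
- move=> [a i]; rewrite mulnDl; apply: msizeM_bound => //=.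
  apply: leq_trans (msize_exp_bound _ (leqnSn (msize g))) _.
  by rewrite ltnS mulnC leq_mul2l -ltnS ltn_ord orbT.
- exact: (indep_on_powers Zirr ge gZ gZ1 ZZ ind).
Qed.

Lemma chain_le_growth (T : Type) (p : T -> 'I_n.+1 -> F) X m d :
  has_chain X m -> (forall f, vanishing p f -> vanishing (@cone_pt _ _ X) f) ->
  hgrowth p d -> (m <= d)%N.
Proof.
move=> [Z [Zi Zlt]] pX; apply: growth_compare.
have [|D Dm] := @chain_family Z m _ Zlt; first by move=> i /Zi[].
exists D => s; have [I [phi [cI phiD ind]]] := Dm s.
exists I, phi; split => // c cv; apply: ind => w.
have Xf : vanishing (@cone_pt _ _ X) (\sum_i c i *: phi i).
  by apply: pX => w'; rewrite -[RHS](cv w') raddf_sum; apply: eq_bigr => i _; rewrite /= mevalZ.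
have : vanishing (@cone_pt _ _ (Z m)) (\sum_i c i *: phi i).
  have [_ ZX] := Zi m (leqnn m).
  by apply/vanishing_cone => q /ZX; apply: (vanishing_cone _ _).1.
by move=> /(_ w) e; rewrite -[RHS]e raddf_sum; apply: eq_bigr => i _; rewrite /= mevalZ.
Qed.

End Chains.

(** * Growth of Hadamard products *)

Local Open Scope quotient_scope.

(** * Dimension as the number of Noether parameters *)

Section Dimension.
Context (F : numClosedFieldType).

Lemma closed_noether n (X : set (point F n)) :
  zariski_closed X -> X !=set0 ->
  exists (m : nat) (u : 'I_m.+1 -> {mpoly F[n.+1]}) (T : nat),
    [/\ forall s, u s \is 1.-homog, finite_over (vanishing (@cone_pt _ _ X)) u T
      & alg_indep (@cone_pt _ _ X) u].
Proof.
move=> Xc X0; apply: noether_normalization; first exact: cone_conic.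
  exact: cone_inhabited.
exact: cone_neq0.
Qed.

(** The number of parameters is squeezed: finiteness and independence produce a chain of length [m],
    and growth bounds every chain by [m]. *)
Lemma has_dim_noether n (X : set (point F n)) d :
  zariski_closed X -> has_dim X d ->
  exists (u : 'I_d.+1 -> {mpoly F[n.+1]}) (T : nat),
    [/\ forall s, u s \is 1.-homog, finite_over (vanishing (@cone_pt _ _ X)) u T
      & alg_indep (@cone_pt _ _ X) u].
Proof.
move=> Xc [Xd Xmax].
have X0 : X !=set0.
  have [Z [/(_ 0%N (leq0n _))[[_ [[p Zp] _]] ZX] _]] := Xd.
  by exists p; apply: ZX.
have [m [u [T [u1 fin ind]]]] := closed_noether Xc X0.
have md : (m <= d)%N by apply: Xmax; apply: finite_over_chain fin ind u1.
have dm : (d <= m)%N by apply: chain_le_growth Xd _ (finite_over_growth fin).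
have e : m = d by apply/eqP; rewrite eqn_leq md.
by subst m; exists u, T.
Qed.

(** The last parameter is cut away repeatedly. Independence is recorded as the attainment of all
    non-zero value vectors, which is how it is used on a product. *)
Lemma linear_section n (X : set (point F n)) d (u : 'I_d.+1 -> {mpoly F[n.+1]}) T a :
  (a <= d)%N -> zariski_closed X -> (forall s, u s \is 1.-homog) ->
  finite_over (vanishing (@cone_pt _ _ X)) u T -> alg_indep (@cone_pt _ _ X) u ->
  exists (Z : set (point F n)) (v : 'I_a.+1 -> {mpoly F[n.+1]}),
    [/\ Z `<=` X, forall s, v s \is 1.-homog,
        finite_over (vanishing (@cone_pt _ _ Z)) v T &
        forall b : 'I_a.+1 -> F, (exists s, b s != 0) ->
          exists w : {x | cone Z x}, forall s, (v s).@[cone_pt w] = b s].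
Proof.
elim: d X u => [|d IH] X u ad Xc u1 fin ind.
  have e : a = 0%N by apply/eqP; rewrite -leqn0.
  by subst a; exists X, u; split => //; apply: cone_lying_over fin ind u1.
have [ad'|da] := leqP a d; last first.
  have e : a = d.+1 by apply/eqP; rewrite eqn_leq ad.
  by subst a; exists X, u; split => //; apply: cone_lying_over fin ind u1.
have [Yc Yfin Yind] := hyperplane_section Xc fin ind u1.
have [//|Z [v [ZY v1 vfin vb]]] := IH _ _ ad' Yc _ Yfin Yind.
by exists Z, v; split => //; apply: subset_trans ZY _ => p [].
Qed.

Lemma hgrowth_ambient (T0 : Type) n (p : T0 -> 'I_n.+1 -> F) : hgrowth p n.
Proof.
apply: (@finite_over_growth _ _ _ _ _ (fun s => 'X_s) 0) => j.
exists (fun s => (s == j)%:R); split.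
  by move=> s; case: eqP => _; [apply: dhomog1|apply: rpred0].
rewrite (bigD1 j)//= eqxx mulr1 big1 => [|s /negPf ->]; last by rewrite mulr0.
by rewrite addr0 expr1 subrr; have [] := vanishing_ideal p.
Qed.

(** The (s+1)^m monomials in [z] with exponents at most [s] are independent and of degree O(s). *)
Lemma alg_indep_growth (T0 : Type) (N m d : nat) (p : T0 -> 'I_N -> F)
    (z : 'I_m -> {mpoly F[N]}) :
  (forall s, z s \is 1.-homog) -> alg_indep p z -> hgrowth p d -> (m <= d.+1)%N.
Proof.
case: m z => [//|m] z z1 ind; rewrite ltnS; apply: growth_compare.
exists m.+1 => s.
exists {ffun 'I_m.+1 -> 'I_s.+1}, (fun a : {ffun 'I_m.+1 -> 'I_s.+1} => \prod_i z i ^+ a i).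
split.
- by rewrite card_ffun !card_ord.
- move=> a; apply: (@leq_trans (\sum_i a i).+1); last first.
    rewrite ltnS -[X in (_ <= X * _)%N](card_ord m.+1) -sum_nat_const.
    by apply: leq_sum => i _; rewrite -ltnS ltn_ord.
  apply: (big_ind2 (fun (f : {mpoly F[N]}) (b : nat) => (msize f <= b.+1)%N)).
  + by rewrite msizeC oner_eq0.
  + by move=> f b g b' fb gb; apply: msizeM_bound.
  + move=> i _; have zi : (msize (z i) <= 2)%N.
      rewrite msizeE; apply/bigmax_leqP_seq => m' m'z _.
      by have /dhomogP/(_ _ m'z) /= -> := z1 i.
    by apply: leq_trans (msize_exp_bound _ zi) _; rewrite muln1.
- move=> c cv.
  pose mu (a : {ffun 'I_m.+1 -> 'I_s.+1}) := [multinom (a i : nat) | i < m.+1].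
  have mu_inj : injective mu.
    by move=> a b /mnmP e; apply/ffunP => i; apply/val_inj; have := e i; rewrite !mnmE.
  have G0 : \sum_a c a *: 'X_[mu a] = 0 :> {mpoly F[m.+1]}.
    apply: ind => w; rewrite -[RHS](cv w) raddf_sum; apply: eq_bigr => a _.
    rewrite /= mevalZ mevalX rmorph_prod /=; congr (_ * _).
    by apply: eq_bigr => i _; rewrite mnmE rmorphXn.
  move=> a; have := congr1 (mcoeff (mu a)) G0.
  rewrite mcoeff0 raddf_sum (bigD1 a)//= mcoeffZ mcoeffX eqxx mulr1 big1 ?addr0//.
  move=> b ba; rewrite mcoeffZ mcoeffX; case: eqP => [/mu_inj e|_]; last by rewrite mulr0.
  by rewrite e eqxx in ba.
Qed.

End Dimension.

(** * Hadamard products as images of products of cones *)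

Section Hadamard.
Context (F : numClosedFieldType) (n k : nat).
Implicit Types (A : 'I_k -> 'M[F]_n.+1) (X : 'I_k -> set (point F n)).

Definition cone_prod X := {x : 'I_k -> 'cV[F]_n.+1 | forall i, cone (X i) (x i)}.

(** Defined on all tuples of representatives, including those whose product is zero and gives no
    point. *)
Definition hadamard_map A X (w : cone_prod X) : 'I_n.+1 -> F :=
  fun j => \prod_i (A i *m sval w i) j 0.

(** Scaling a single factor multiplies the coordinatewise product by exactly [t]. *)
Definition rescale (i0 : 'I_k) (t : F) (x : 'I_k -> 'cV[F]_n.+1) :=
  fun i => if i == i0 then t *: x i else x i.

Lemma rescale_cone X (w : cone_prod X) i0 t : t != 0 ->
  forall i, cone (X i) (rescale i0 t (sval w) i).
Proof.
move=> t0 i; have [p Xp px] := svalP w i; exists p => //; rewrite /rescale.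
by case: eqP => // _; apply: coordsZ.
Qed.

Lemma hadamard_map_conic A X : (0 < k)%N -> conic (@hadamard_map A X).
Proof.
move=> k0 w t t0; exists (exist _ _ (rescale_cone w (Ordinal k0) t0)) => j.
rewrite /hadamard_map /= (bigD1 (Ordinal k0))//= [in RHS](bigD1 (Ordinal k0))//=.
rewrite {1}/rescale eqxx -scalemxAr mxE mulrA; congr (_ * _).
by apply: eq_bigr => i /negPf i0; rewrite /rescale i0.
Qed.

Lemma hadamard_map_growth A X (d : 'I_k -> nat) :
  (forall i, hgrowth (@cone_pt _ _ (X i)) (d i)) ->
  hgrowth (@hadamard_map A X) (\sum_i d i).
Proof.
move=> /choice[C hC]; exists (\prod_i C i)%N => t.
pose r i := (C i * t.+1 ^ d i)%N.
have /choice[psi psiP] : forall i, exists psi : nat -> 'cV[F]_n.+1 -> F,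
    forall f : {mpoly F[n.+1]}, f \is t.-homog -> exists c : nat -> F,
    forall x, cone (X i) x -> f.@[fun j => x j 0] = \sum_(a < r i) c a * psi a x.
  move=> i; have [psi h] := hC i t.
  exists (fun a x => if pselect (cone (X i) x) is left hx then psi a (exist _ x hx) else 0).
  move=> f ft; have [|c cE] := h (fun w => f.@[cone_pt w]); first by exists f.
  exists c => x; case: pselect => // hx _; exact: (cE (exist _ x hx)).
pose M := (\sum_i r i)%N.
have rM i : (r i <= M)%N by rewrite /M (bigD1 i)//= leq_addr.
(* [family Q] consists of the choices of one index below [r i] for every [i], within the common
   range [M]; their number is the product of the [r i]. *)
pose Q (i : 'I_k) (a : 'I_M) := (a < r i)%N.
apply: (@spanned_fin _ _ _ _ 'I_#|family Q|
   (fun j w => \prod_i psi i (enum_val j i) (sval w i))).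
  rewrite card_ord card_family foldrE big_map big_enum /=.
  apply: (@leq_trans (\prod_i r i)); last by rewrite big_split /= expn_sum.
  apply: leq_prod => i _; rewrite -sum1_card.
  by rewrite -(big_ord_widen M (fun=> 1%N) (rM i)) sum1_card card_ord.
move=> _ [f ft ->].
pose lin i j : {mpoly F[n.+1]} := \sum_l A i j l *: 'X_l.
have lin1 i j : lin i j \is 1.-homog.
  by apply: rpred_sum => l _; apply: dhomogZ; rewrite dhomogX /= mdeg1.
have linE i j (v : 'cV[F]_n.+1) : (lin i j).@[fun l => v l 0] = (A i *m v) j 0.
  by rewrite /lin raddf_sum mxE; apply: eq_bigr => l _; rewrite /= mevalZ mevalXU.
have cP : forall nu : 'X_{1..n.+1}, exists c : 'I_#|family Q| -> F,
    mdeg nu = t -> forall w : cone_prod X, \prod_j hadamard_map A w j ^+ nu j =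
      \sum_j c j * \prod_i psi i (enum_val j i) (sval w i).
  move=> nu; have [nut|] := pselect (mdeg nu = t); last by exists (fun=> 0).
  (* A monomial of degree [t] in the product coordinates splits as a product over [i] of forms of
     degree [t], one for each factor. *)
  pose g i := \prod_j lin i j ^+ nu j.
  have gt i : g i \is t.-homog.
    rewrite /g -nut mdegE.
    apply: (big_ind2 (fun f e => f \is e.-homog)); first exact: dhomog1.
      by move=> f1 e1 f2 e2; apply: dhomogM.
    by move=> j _; have := dhomogMn (nu j) (lin1 i j); rewrite mul1n.
  have [c cE] := choice (fun i => psiP i _ (gt i)).
  exists (fun j : 'I_#|family Q| => \prod_i c i (enum_val j i)) => _ w.
  transitivity (\prod_i (g i).@[fun l => sval w i l 0]).
    under [RHS]eq_bigr => i _.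
      rewrite rmorph_prod /=.
      under eq_bigr => j _ do rewrite rmorphXn /= linE.
      over.
    rewrite exchange_big; apply: eq_bigr => j _ /=.
    by rewrite /hadamard_map -prodrXl.
  under eq_bigr => i _.
    rewrite (cE i _ (svalP w i)) (big_ord_widen _ (fun a => c i a * psi i a (sval w i)) (rM i)).
    over.
  rewrite (bigA_distr_big_dep _ (fun i (a : 'I_M) => c i a * psi i a (sval w i))).
  rewrite big_enum_val; apply: eq_bigr => j _.
  by rewrite big_split.
have [c cE] := choice cP.
exists (fun j => \sum_(nu <- msupp f) f@_nu * c nu j) => w.
rewrite mevalE; under [RHS]eq_bigr do rewrite mulr_suml.
rewrite exchange_big; apply: eq_big_seq => nu nuf /=.
have /dhomogP/(_ _ nuf)/= nut := ft.
rewrite cE// mulr_sumr; apply: eq_bigr => j _.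
by rewrite mulrA.
Qed.

Lemma PGL_eqP (A B : GL F n.+1) :
  \pi_(PGL F n.+1) A = \pi_(PGL F n.+1) B <->
  exists2 t, t != 0 & val A = t *: val B.
Proof.
split=> [/eqmodP/vlineP[t AB]|[t _ AB]]; last first.
  have /eqmodP : scalar_multiple_equiv F n.+1 A B by apply/vlineP; exists t.
  exact.
exists t => //; apply/eqP => t0; have := valP A.
by rewrite AB t0 scale0r unitmxE det0 unitr0.
Qed.

Lemma cone_image (A : GL F n.+1) (X : set (point F n)) y :
  cone (image_by (\pi_(PGL F n.+1) A) X) y <->
  exists2 x, cone X x & y = val A *m x.
Proof.
split=> [[q [p Xp [B [x [/PGL_eqP[t t0 BA] px qx]]]] qy]|[x [p Xp px] ->]].
  have [s s0 ->] := coords_proportional qx qy.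
  exists (s *: (t *: x)); first by exists p => //; do 2!apply: coordsZ => //.
  by rewrite BA -scalemxAl -!scalemxAr.
have Ax0 : val A *m x != 0.
  have [x0 _] := px; apply: contra x0 => /eqP Ax.
  by rewrite -[x](mulKmx (valP A)) Ax mulmx0.
have [q qA] := point_of Ax0; exists q => //; exists p => //.
by exists A, x.
Qed.

Lemma hadamard_products_coords (A : 'I_k -> GL F n.+1) X q y :
  (0 < k)%N ->
  hadamard_products (fun i => image_by (\pi_(PGL F n.+1) (A i)) (X i)) q ->
  coords q y -> exists w : cone_prod X, forall j, y j 0 =
    hadamard_map (fun i => val (A i)) w j.
Proof.
move=> k0 [P XP [x [Px qx]]] qy.
have /choice[z zE] : forall i, exists z, cone (X i) z /\ x i = val (A i) *m z.
  move=> i; have [|z ? ?] := (cone_image (A i) (X i) (x i)).1; last by exists z.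
  by exists (P i).
have [t t0 ->] := coords_proportional qx qy.
pose w : cone_prod X := exist _ z (fun i => (zE i).1).
have [w' w'E] := hadamard_map_conic (fun i => val (A i)) k0 w t0.
exists w' => j; rewrite w'E !mxE; congr (_ * _).
by apply: eq_bigr => i _; rewrite (zE i).2.
Qed.

Lemma hadamard_map_products (A : 'I_k -> GL F n.+1) X (w : cone_prod X) j0 :
  hadamard_map (fun i => val (A i)) w j0 != 0 ->
  exists q y, [/\
    hadamard_products (fun i => image_by (\pi_(PGL F n.+1) (A i)) (X i)) q,
    coords q y & forall j, y j 0 = hadamard_map (fun i => val (A i)) w j].
Proof.
move=> wj0; pose y : 'cV[F]_n.+1 := \col_j \prod_i (val (A i) *m sval w i) j 0.
have yE j : y j 0 = hadamard_map (fun i => val (A i)) w j by rewrite mxE.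
have y0 : y != 0 by apply: contra wj0 => /eqP y0; rewrite -yE y0 mxE.
have [q qy] := point_of y0; exists q, y; split => //.
have /choice[P PE] : forall i, exists P,
    image_by (\pi_(PGL F n.+1) (A i)) (X i) P /\ coords P (val (A i) *m sval w i).
  move=> i; have [|P ? ?] := (cone_image (A i) (X i) (val (A i) *m sval w i)).2.
    by exists (sval w i) => //; exact: (svalP w i).
  by exists P.
exists P; first by move=> i; exact: (PE i).1.
by exists (fun i => val (A i) *m sval w i); split => // i; exact: (PE i).2.
Qed.

Lemma hadamard_vanishing (A : 'I_k -> GL F n.+1) X f : (0 < k)%N ->
  vanishing (@hadamard_map (fun i => val (A i)) X) f ->
  vanishing (@cone_pt _ _
    (hadamard (fun i => image_by (\pi_(PGL F n.+1) (A i)) (X i)))) f.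
Proof.
move=> k0 f0; apply/vanishing_cone => p; apply; first exact: zariski_closed_vanishes.
move=> q qX y /(hadamard_products_coords k0 qX)[w wE].
by rewrite (meval_eq _ wE) f0.
Qed.

End Hadamard.

(** * Finiteness of a projection of the Segre variety *)

Section OpenFiniteness.
Context (F : numClosedFieldType).

(** A non-vanishing minor of maximal size gives a basis: every bordered minor is zero, and this
    expresses each remaining function in the chosen ones. *)
Lemma finite_family_basis (T : Type) (I : finType) (phi : I -> T -> F) :
  exists (r : nat) (a : 'I_r -> I) (pts : 'I_r -> T),
    \det (\matrix_(b, c) phi (a b) (pts c)) != 0 /\
    forall i, exists x : 'rV[F]_r, forall w, phi i w = \sum_b x 0 b * phi (a b) w.
Proof.
pose P r := `[< exists (a : 'I_r -> I) (pts : 'I_r -> T),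
  \det (\matrix_(b, c) phi (a b) (pts c)) != 0 >].
have P0 : exists r, P r.
  exists 0%N; apply/asboolP.
  have f0 S : 'I_0 -> S by case.
  by exists (f0 _), (f0 _); rewrite det_mx00 oner_eq0.
have Pr r : P r -> (r <= #|I|)%N.
  move=> /asboolP[a [pts d]]; rewrite -(card_ord r); apply: (leq_card a).
  move=> b b' bb'; apply/eqP; apply: contraNT d => nbb'; apply/eqP.
  by apply: (determinant_alternate nbb') => c; rewrite !mxE bb'.
have [r /asboolP[a [pts d]] rmax] := ex_maxnP P0 Pr.
exists r, a, pts; split => // i; set M := \matrix_(b, c) _ in d.
have Mu : M \in unitmx by rewrite unitmxE unitfE.
pose v := (\row_c phi i (pts c)) *m invmx M.
exists v => w0; apply/eqP; rewrite -subr_eq0; apply/negPn/negP => nz.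
pose a' (b : 'I_(r + 1)) := if split b is inl b' then a b' else i.
pose pts' (c : 'I_(r + 1)) := if split c is inl c' then pts c' else w0.
suff /rmax : P (r + 1)%N by rewrite addn1 ltnn.
apply/asboolP; exists a', pts'.
(* A row operation clears the last row except for its corner, where the defect of the claimed
   identity at [w0] appears. *)
pose L : 'M[F]_(r + 1) := block_mx 1%:M 0 (- v) 1%:M.
have -> : \det (\matrix_(b, c) phi (a' b) (pts' c)) =
    \det (L *m \matrix_(b, c) phi (a' b) (pts' c)).
  by rewrite det_mulmx det_lblock !det1 !mul1r.
have -> : \matrix_(b, c) phi (a' b) (pts' c) =
    block_mx M (\col_b phi (a b) w0) (\row_c phi i (pts c)) (phi i w0)%:M.
  apply/matrixP => b c; rewrite !mxE /a' /pts'.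
  by case: (split b) => b'; rewrite !mxE; case: (split c) => c'; rewrite !mxE ?ord1.
rewrite /L mulmx_block !mul1mx !mul0mx !addr0 !mulNmx {1}/v mulmxKV//.
rewrite addNr det_ublock mulf_neq0//.
rewrite det_mx11 mxE [X in X + _]mxE [X in _ + X]mxE eqxx mulr1n addrC mxE.
by rewrite (eq_bigr (fun b => v 0 b * phi (a b) w0))// => b _; rewrite !mxE.
Qed.

(** In degree [d.+1] a basis of monomials on [p] is written through [y0]. Replacing [y0] by [y] in
    these expressions gives another basis when the determinant is non-zero, so the ideal of [y]
    still contains that degree. *)
Lemma finite_over_open (T0 : Type) (N m T : nat) (p : T0 -> 'I_N -> F)
    (y0 : 'I_m -> {mpoly F[N]}) :
  conic p -> (forall s, y0 s \is 1.-homog) ->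
  finite_over (vanishing p) y0 T ->
  exists (r : nat) (pts : 'I_r -> T0) (q : 'I_r -> 'I_m -> {mpoly F[N]}),
    let D y := \det (\matrix_(b, c) \sum_s (y s).@[p (pts c)] * (q b s).@[p (pts c)]) in
    D y0 != 0 /\
    forall y : 'I_m -> {mpoly F[N]}, (forall s, y s \is 1.-homog) -> D y != 0 ->
      exists T', finite_over (vanishing p) y T'.
Proof.
move=> pc y01 fin; pose d := (N * T.+1)%N.
have vi := vanishing_ideal p.
pose phi (nu : 'X_{1..N < d.+2}) w : F :=
  if mdeg nu == d.+1 then ('X_[nu] : {mpoly F[N]}).@[p w] else 0.
have [r [a [pts [det0 span]]]] := finite_family_basis phi.
have qP b : exists q : 'I_m -> {mpoly F[N]}, (forall s, q s \is d.-homog) /\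
    forall w, phi (a b) w = \sum_s (y0 s).@[p w] * (q s).@[p w].
  rewrite /phi; case: eqP => [deg|_]; last first.
    exists (fun=> 0); split=> [s|w]; first exact: rpred0.
    by rewrite big1// => s _; rewrite meval0 mulr0.
  (* The degree [d.+1] exceeds N T, so some exponent exceeds [T]. *)
  have [j jT] : exists j, (T < (a b : 'X_{1..N}) j)%N.
    apply: contrapT => /forallNP h; have : (mdeg (a b) <= N * T)%N.
      rewrite mdegE -[X in (_ <= X * _)%N](card_ord N) -sum_nat_const.
      by apply: leq_sum => j _; rewrite leqNgt; apply/negP; apply: h.
    by rewrite deg /d mulnS ltnNge leq_addl.
  have [q [qT qv]] := fin j.
  have abE : (a b : 'X_{1..N}) = ((a b - U_(j) *+ T.+1) + U_(j) *+ T.+1)%MM.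
    rewrite submK//; apply/mnm_lepP => l; rewrite mulmnE mnm1E.
    by case: eqP => [<-|_]; rewrite ?mul1n ?mul0n.
  set m1 := (a b - U_(j) *+ T.+1)%MM in abE.
  have m1d : (mdeg m1 + T)%N = d.
    by apply/succn_inj; rewrite -deg abE mdegD mdegMn mdeg1 mul1n addnS.
  exists (fun s => 'X_[m1] * q s); split=> [s|w].
    by rewrite -m1d; apply: dhomogM (qT s); rewrite dhomogX.
  rewrite abE mpolyXD -mpolyXn mevalM rmorphXn /=.
  have := qv w; rewrite mevalB rmorphXn /= => /eqP; rewrite subr_eq0 => /eqP ->.
  rewrite raddf_sum mulr_sumr; apply: eq_bigr => s _ /=.
  by rewrite !mevalM mulrCA.
have /choice[q qE] := qP.
exists r, pts, q => D; split.
  suff -> : D y0 = \det (\matrix_(b, c) phi (a b) (pts c)) by [].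
  by congr (\det _); apply/matrixP => b c; rewrite !mxE (qE b).2.
move=> y y1 Dy; pose g b := \sum_s y s * q b s.
have gd b : g b \is d.+1.-homog.
  by apply: rpred_sum => s _; rewrite -add1n; apply: dhomogM (y1 s) ((qE b).1 s).
have gspan b : exists x : 'rV[F]_r, forall w, (g b).@[p w] = \sum_b' x 0 b' * phi (a b') w.
  have /choice[x xE] := span; exists (\sum_(nu : 'X_{1..N < d.+2}) (g b)@_nu *: x nu) => w.
  have gs : (msize (g b) <= d.+2)%N.
    rewrite msizeE; apply/bigmax_leqP_seq => nu nug _.
    by have /dhomogP/(_ _ nug)/= -> := gd b.
  rewrite {1}(mpolywE gs) raddf_sum.
  transitivity (\sum_(nu : 'X_{1..N < d.+2}) \sum_b' (g b)@_nu * (x nu 0 b' * phi (a b') w)).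
    apply: eq_bigr => nu _; rewrite /= mevalZ -mulr_sumr -xE /phi.
    case: eqP => // /eqP nud; rewrite (@dhomog_nemf_coeff _ _ mdeg d.+1)// mul0r.
    by rewrite mul0r.
  rewrite exchange_big; apply: eq_bigr => b' _ /=.
  by rewrite summxE mulr_suml; apply: eq_bigr => nu _; rewrite mxE mulrA.
have /choice[x xE] := gspan.
pose P : 'M[F]_r := \matrix_b x b.
(* [P] expresses the forms [g b] in the basis; [D y] is its determinant times the non-zero minor. *)
have Pu : P \in unitmx.
  rewrite unitmxE unitfE; apply: contra Dy => /eqP P0.
  suff -> : D y = \det P * \det (\matrix_(b, c) phi (a b) (pts c)) by rewrite P0 mul0r.
  rewrite -det_mulmx; congr (\det _); apply/matrixP => b c.
  have := xE b (pts c); rewrite /g raddf_sum !mxE.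
  under eq_bigr do rewrite /= mevalM.
  by move=> ->; apply: eq_bigr => b' _; rewrite !mxE.
have phig b w : phi (a b) w = \sum_b' invmx P b b' * (g b').@[p w].
  transitivity ((invmx P *m (P *m \col_b' phi (a b') w)) b 0).
    by rewrite mulmxA mulVmx// mul1mx mxE.
  rewrite mxE; apply: eq_bigr => b' _; rewrite xE; congr (_ * _).
  by rewrite mxE; apply: eq_bigr => b'' _; rewrite !mxE.
apply: finite_over_add_ideal => //; first by move=> f e; apply: vanishing_pihomog.
move=> j; exists d.+1.
have jd : (mdeg (U_(j) *+ d.+1) < d.+2)%N by rewrite mdegMn mdeg1 mul1n.
have [z zE] := span (BMultinom jd).
have [I0 ID IM] := add_ideal_ideal y vi.
pose h := \sum_b \sum_b' (z 0 b * invmx P b b') *: g b'.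
rewrite -['X_j ^+ _](subrK h); apply: (ID).
  apply: add_ideal_sub => w; rewrite mevalB mpolyXn.
  have := zE w; rewrite {1}/phi /= mdegMn mdeg1 mul1n eqxx => ->.
  apply/eqP; rewrite subr_eq0; apply/eqP.
  rewrite /h raddf_sum; apply: eq_bigr => b _; rewrite raddf_sum phig mulr_sumr.
  by apply: eq_bigr => b' _; rewrite /= mevalZ mulrA.
apply: ideal_sum => // b _; apply: ideal_sum => // b' _.
rewrite -mul_mpolyC; apply: (IM); apply: ideal_sum => // s _.
by rewrite mulrC; apply: (IM); apply: add_ideal_gen.
Qed.

End OpenFiniteness.

(** * Radicals and the Segre embedding *)

Section Segre.
Context (F : numClosedFieldType).

Definition radical (N : nat) (J : set {mpoly F[N]}) : set {mpoly F[N]} :=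
  [set f | exists e, J (f ^+ e)].

Lemma radicalM (N : nat) (J : set {mpoly F[N]}) f g :
  ideal J -> radical J g -> radical J (f * g).
Proof. by move=> [_ _ JM] [e ge]; exists e; rewrite exprMn; apply: JM. Qed.

Lemma radicalD (N : nat) (J : set {mpoly F[N]}) f g :
  ideal J -> radical J f -> radical J g -> radical J (f + g).
Proof.
move=> Ji [a fa] [b gb]; have [_ _ JM] := Ji.
exists (a + b)%N; rewrite exprDn; apply: ideal_sum => // i _.
rewrite -mulr_natl; apply: (JM); have [bi|ib] := leqP b i.
  by rewrite -(subnK bi) exprD mulrA; apply: JM.
rewrite mulrC; apply: (JM); rewrite (_ : a + b - i = (b - i) + a)%N; last by lia.
by rewrite exprD; apply: JM.
Qed.

Lemma radical_ideal (N : nat) (J : set {mpoly F[N]}) : ideal J -> ideal (radical J).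
Proof.
move=> Ji; split; last by move=> f g; apply: radicalM.
  by exists 1%N; rewrite expr1; case: Ji.
by move=> f g; apply: radicalD.
Qed.

Lemma sub_radical (N : nat) (J : set {mpoly F[N]}) : J `<=` radical J.
Proof. by move=> f Jf; exists 1%N; rewrite expr1. Qed.

Lemma radical_exp (N : nat) (J : set {mpoly F[N]}) f e :
  radical J (f ^+ e) -> radical J f.
Proof. by move=> [e' h]; exists (e * e')%N; rewrite exprM. Qed.

Lemma finite_over_le (N m T T' : nat) (J : set {mpoly F[N]}) (u : 'I_m -> {mpoly F[N]}) :
  ideal J -> (T <= T')%N -> finite_over J u T -> finite_over J u T'.
Proof.
move=> [_ _ JM] TT' fin j; have [q [qT qJ]] := fin j.
exists (fun s => 'X_j ^+ (T' - T) * q s); split=> [s|].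
  rewrite -[X in X.-homog](subnK TT'); apply: dhomogM (qT s).
  have := @dhomogMn _ _ mdeg 1 ('X_j : {mpoly F[N]}) (T' - T).
  by rewrite mul1n; apply; rewrite dhomogX /= mdeg1.
have -> : T'.+1 = (T' - T + T.+1)%N by rewrite addnS subnK.
under eq_bigr do rewrite mulrCA.
by rewrite exprD -mulr_sumr -mulrBr; apply: JM.
Qed.

Lemma homogS (N t : nat) (f : {mpoly F[N]}) : f \is t.+1.-homog ->
  exists h : 'I_N -> {mpoly F[N]},
    (forall l, h l \is t.-homog) /\ f = \sum_l 'X_l * h l.
Proof.
move=> /dhomogP ft; rewrite (mpolyE f) big_seq.
apply: (big_ind (fun f => exists h : 'I_N -> {mpoly F[N]},
    (forall l, h l \is t.-homog) /\ f = \sum_l 'X_l * h l)).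
- exists (fun=> 0); split=> [l|]; first exact: rpred0.
  by rewrite big1// => l _; rewrite mulr0.
- move=> f1 f2 [h1 [h1t ->]] [h2 [h2t ->]]; exists (fun l => h1 l + h2 l).
  split=> [l|]; first by rewrite rpredD.
  by rewrite -big_split; apply: eq_bigr => l _; rewrite mulrDr.
- move=> m mf; have /= mt := ft m mf.
  have [l0 ml0] : exists l0, m l0 != 0%N.
    apply: contrapT => /forallNP m0; move: mt; rewrite mdegE big1// => l _.
    by apply/eqP/negPn/negP; apply: m0.
  have mE : m = (U_(l0) + (m - U_(l0)))%MM by rewrite addmC submK// lep1mP.
  exists (fun l => if l == l0 then f@_m *: 'X_[m - U_(l0)] else 0); split.
    move=> l; case: eqP => _; last exact: rpred0.
    apply: dhomogZ; rewrite dhomogX /=; apply/eqP/succn_inj.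
    by rewrite -mt {2}mE mdegD mdeg1 add1n.
  rewrite (bigD1 l0)//= eqxx big1 => [|l /negPf ->]; last by rewrite mulr0.
  by rewrite addr0 -scalerAr -mpolyXD -mE.
Qed.

Lemma homog1_eval (N : nat) (f : {mpoly F[N]}) (v : 'I_N -> F) :
  f \is 1.-homog -> f.@[v] = \sum_l f@_U_(l) * v l.
Proof.
move=> /homogS[h [h0 ->]].
have hE l : h l = ((h l)@_0%MM)%:MP by apply: homog0E.
rewrite raddf_sum; apply: eq_bigr => l _ /=.
rewrite mevalM mevalXU hE mevalC mulrC; congr (_ * _).
rewrite raddf_sum (bigD1 l)//= hE mulrC mul_mpolyC mcoeffZ mcoeffX mcoeffC !eqxx !mulr1.
rewrite big1 ?addr0// => l' l'l; rewrite hE mulrC mul_mpolyC mcoeffZ mcoeffX.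
by rewrite eq_mnm1 (negPf l'l) mulr0.
Qed.

Context (n k : nat).
Notation Idx := {ffun 'I_k -> 'I_n.+1}.
Implicit Types (Z : 'I_k -> set (point F n)) (f : 'I_k -> {mpoly F[n.+1]}).

Definition idx (J : 'I_#|{: Idx}|) : Idx := enum_val J.

Definition segre Z (w : cone_prod Z) : 'I_#|{: Idx}| -> F :=
  fun J => \prod_i sval w i (idx J i) 0.

(** The linear form on the Segre space that restricts to the product of the linear forms [f i]. *)
Definition segre_form f : {mpoly F[#|{: Idx}|]} :=
  \sum_J (\prod_i (f i)@_U_(idx J i)) *: 'X_J.

Lemma segre_form_homog f : segre_form f \is 1.-homog.
Proof. by apply: rpred_sum => J _; apply: dhomogZ; rewrite dhomogX /= mdeg1. Qed.

Lemma prod_sum_idx (h : 'I_k -> 'I_n.+1 -> F) :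
  \prod_i \sum_l h i l = \sum_(J < #|{: Idx}|) \prod_i h i (idx J i).
Proof.
rewrite bigA_distr_bigA /= (reindex (@enum_val {: Idx} predT))//=.
exact/onW_bij/enum_val_bij.
Qed.

Lemma segre_form_eval Z (w : cone_prod Z) f : (forall i, f i \is 1.-homog) ->
  (segre_form f).@[segre w] = \prod_i (f i).@[fun l => sval w i l 0].
Proof.
move=> f1; under [RHS]eq_bigr do rewrite homog1_eval//.
rewrite prod_sum_idx raddf_sum; apply: eq_bigr => J _ /=.
by rewrite mevalZ mevalXU /segre big_split.
Qed.

Lemma segre_conic Z : (0 < k)%N -> conic (@segre Z).
Proof.
move=> k0 w t t0; exists (exist _ _ (rescale_cone w (Ordinal k0) t0)) => j.
rewrite /segre /= (bigD1 (Ordinal k0))//= [in RHS](bigD1 (Ordinal k0))//=.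
rewrite {1}/rescale eqxx mxE mulrA; congr (_ * _).
by apply: eq_bigr => i /negPf i0; rewrite /rescale i0.
Qed.

Lemma segre_neq0 Z (w : cone_prod Z) : exists J, segre w J != 0.
Proof.
have /choice[l lP] : forall i, exists l, sval w i l 0 != 0.
  by move=> i; apply: (cone_neq0 (exist _ _ (svalP w i))).
exists (enum_rank [ffun i => l i]); apply/prodf_neq0 => i _.
by rewrite /idx enum_rankK ffunE.
Qed.

(** Splitting one variable off every factor leaves a Segre coordinate times a product of forms of
    lower degree. *)
Lemma segre_lift Z t f : (forall i, f i \is t.-homog) ->
  exists Q, forall w : cone_prod Z,
    Q.@[segre w] = \prod_i (f i).@[fun l => sval w i l 0].
Proof.
elim: t f => [|t IH] f ft.
  exists (\prod_i (f i)@_0%MM)%:MP => w; rewrite mevalC; apply: eq_bigr => i _.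
  by rewrite [in RHS](homog0E (ft i)) mevalC.
have /choice[h hE] := fun i => homogS (ft i).
have /choice[Q QE] : forall J : 'I_#|{: Idx}|, exists Q, forall w : cone_prod Z,
    Q.@[segre w] = \prod_i (h i (idx J i)).@[fun l => sval w i l 0].
  by move=> J; apply: IH => i; apply: (hE i).1.
exists (\sum_J 'X_J * Q J) => w.
under [RHS]eq_bigr => i _ do rewrite (hE i).2 raddf_sum.
rewrite prod_sum_idx raddf_sum; apply: eq_bigr => J _ /=.
rewrite mevalM mevalXU QE /segre -big_split; apply: eq_bigr => i _ /=.
by rewrite mevalM mevalXU.
Qed.

End Segre.

(** * A special finite projection, and independent forms on the Segre variety *)

Section SegreProjection.
Context (F : numClosedFieldType) (n k : nat).
Implicit Types (Z : 'I_k -> set (point F n)) (A : 'I_k -> 'M[F]_n.+1).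

Definition row_form (B : 'M[F]_n.+1) (j : 'I_n.+1) : {mpoly F[n.+1]} :=
  \sum_l B j l *: 'X_l.

Lemma row_form_homog B j : row_form B j \is 1.-homog.
Proof. by apply: rpred_sum => l _; apply: dhomogZ; rewrite dhomogX /= mdeg1. Qed.

Lemma row_form_eval B j (x : 'cV[F]_n.+1) :
  (row_form B j).@[fun l => x l 0] = (B *m x) j 0.
Proof. by rewrite raddf_sum mxE; apply: eq_bigr => l _; rewrite /= mevalZ mevalXU. Qed.

Definition hadamard_form A (j : 'I_n.+1) := segre_form (fun i => row_form (A i) j).

Lemma hadamard_form_eval Z A (w : cone_prod Z) j :
  (hadamard_form A j).@[segre w] = hadamard_map A w j.
Proof.
rewrite segre_form_eval; last by move=> i; apply: row_form_homog.
by apply: eq_bigr => i _; rewrite row_form_eval.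
Qed.

Lemma Vandermonde_nat_unit (e : nat) :
  Vandermonde e (\row_(j < e) (j%:R : F)) \in unitmx.
Proof.
rewrite unitmxE unitfE det_Vandermonde; apply/prodf_neq0 => i _.
apply/prodf_neq0 => j ij; rewrite !mxE subr_eq0 eqr_nat.
by rewrite eq_sym (ltn_eqF ij).
Qed.

(* The rows are [sum_s j^s V_i,s]: the [j]-th form is then the value at [j] of
   the product of the polynomials [sum_s V_i,s x^s], whose coefficients are
   [sum_(|sigma| = m) prod_i V_i,sigma(i)]. *)
Lemma special_projection Z (a : 'I_k -> nat) (e T : nat)
    (u : forall i, 'I_(a i).+1 -> {mpoly F[n.+1]}) (he : (e.+1 <= n.+1)%N) :
  (0 < k)%N -> e = (\sum_i a i)%N -> (forall i s, u i s \is 1.-homog) ->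
  (forall i, finite_over (vanishing (@cone_pt _ _ (Z i))) (u i) T) ->
  exists A T', finite_over (vanishing (@segre _ _ _ Z))
    (fun s : 'I_e.+1 => hadamard_form A (widen_ord he s)) T'.
Proof.
move=> k0 eE u1 fin.
(* Padding with zero beyond [a i] lets all factors share one index type. *)
pose V i (s : 'I_n.+1) := if (s <= a i)%N then u i (inord s) else 0.
have V1 i s : V i s \is 1.-homog by rewrite /V; case: ifP => // _; apply: rpred0.
have ae i : (a i <= e)%N by rewrite eE (bigD1 i)//= leq_addr.
pose A i : 'M[F]_n.+1 := \matrix_(j, l) \sum_(s < n.+1) j%:R ^+ s * (V i s)@_U_(l).
pose y (s : 'I_e.+1) := hadamard_form A (widen_ord he s).
exists A; rewrite -/y.
pose I := add_ideal (vanishing (@segre _ _ _ Z)) y.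
have vi := vanishing_ideal (@segre _ _ _ Z).
have Ii : ideal I by apply: add_ideal_ideal.
have [I0 ID IM] := Ii.
have Ri := radical_ideal Ii; have [R0 RD RM] := Ri.
pose Idx := {ffun 'I_k -> 'I_n.+1}.
pose U (sg : Idx) := segre_form (fun i => V i (sg i)).
have UE sg (w : cone_prod Z) : (U sg).@[segre w] = \prod_i (V i (sg i)).@[fun l => sval w i l 0].
  by apply: segre_form_eval => i.
pose wt (sg : Idx) := (\sum_i sg i)%N.
pose c m := \sum_(sg | wt sg == m) U sg.
(* A weight above the sum of the [a i] forces a padded, hence zero, factor. *)
have U0 sg : (e < wt sg)%N -> vanishing (@segre _ _ _ Z) (U sg).
  move=> esg w; have [i ai] : exists i, (a i < sg i)%N.
    apply: contrapT => /forallNP h; move: esg; rewrite ltnNge eE leq_sum// => i _.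
    by rewrite leqNgt; apply/negP; apply: h.
  by rewrite UE (bigD1 i)//= /V leqNgt ai /= meval0 mul0r.
have yE s (w : cone_prod Z) : (y s).@[segre w] = \sum_(m < e.+1) (c m).@[segre w] * s%:R ^+ m.
  rewrite hadamard_form_eval /hadamard_map.
  transitivity (\prod_i \sum_(r < n.+1) s%:R ^+ r * (V i r).@[fun l => sval w i l 0]).
    apply: eq_bigr => i _; rewrite mxE.
    under eq_bigr do rewrite mxE mulr_suml.
    rewrite exchange_big; apply: eq_bigr => r _ /=.
    rewrite homog1_eval// mulr_sumr; apply: eq_bigr => l _.
    by rewrite mulrA.
  rewrite bigA_distr_bigA /=.
  transitivity (\sum_(sg : Idx) s%:R ^+ wt sg * (U sg).@[segre w]).
    by apply: eq_bigr => sg _; rewrite big_split UE expr_sum.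
  rewrite (bigID (fun sg => wt sg < e.+1)%N) /= [X in _ + X]big1 ?addr0; last first.
    by move=> sg; rewrite -leqNgt => /U0 ->; rewrite mulr0.
  rewrite (partition_big (fun sg => inord (wt sg) : 'I_e.+1) predT)//=.
  apply: eq_bigr => m _; rewrite /c raddf_sum mulr_suml /=.
  apply: eq_big => [sg|sg].
    apply/andP/eqP => [[sge /eqP <-]|->]; first by rewrite inordK.
    by rewrite ltn_ord; split => //; apply/eqP/val_inj; rewrite /= inordK.
  by move=> /andP[sge /eqP <-]; rewrite inordK// mulrC.
have Ic m : I (c m).
  have [me|em] := leqP m e; last first.
    apply: ideal_sum => // sg /eqP sgm; apply: add_ideal_sub.
    by apply: U0; rewrite sgm.
  (* The [y s] are the values at 0, ..., e of the polynomial with coefficients [c m]; Vandermonde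
     inversion recovers these coefficients. *)
  pose W := Vandermonde e.+1 (\row_(j < e.+1) (j%:R : F)).
  pose h := \sum_s invmx W s (inord m) *: y s.
  rewrite -[c m](subrK h); apply: (ID).
    apply: add_ideal_sub => w; apply/eqP; rewrite mevalB subr_eq0; apply/eqP.
    pose cw : 'rV[F]_e.+1 := \row_m (c m).@[segre w].
    have yw : \row_s (y s).@[segre w] = cw *m W.
      by apply/rowP => s; rewrite mxE yE mxE; apply: eq_bigr => m' _; rewrite !mxE.
    have : cw = (\row_s (y s).@[segre w]) *m invmx W.
      by rewrite yw mulmxK// Vandermonde_nat_unit.
    move=> /rowP/(_ (inord m)); rewrite mxE inordK// => ->.
    rewrite mxE /h raddf_sum; apply: eq_bigr => s _.
    by rewrite /= mevalZ mxE mulrC.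
  apply: ideal_sum => // s _; rewrite -mul_mpolyC; apply: IM.
  exact: add_ideal_gen.
(* Induction on the weight: the square of [U sg] is [U sg * c m] minus products of [U sg] with the
   other [U rho] of the same weight, so it suffices to treat these products. *)
have RU m sg : wt sg = m -> radical I (U sg).
  elim/ltn_ind: m sg => m IH sg sgm; apply: (radical_exp (e := 2)).
  have -> : U sg ^+ 2 = U sg * c m - \sum_(rho | (wt rho == m) && (rho != sg)) U sg * U rho.
    by rewrite -mulr_sumr /c (bigD1 sg) ?sgm//= mulrDr addrK.
  apply: (idealB Ri); first by apply: sub_radical; apply: IM.
  apply: (ideal_sum _ Ri) => rho /andP[/eqP rhom rs].
  have [i si] : exists i, (sg i < rho i)%N.
    apply: contrapT => /forallNP h; move/eqP: rs; apply.
    have le i : (rho i <= sg i)%N by rewrite leqNgt; apply/negP; apply: h.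
    have := leqif_sum (fun i (_ : true) => leqif_eq (le i)).
    move=> /leqifP; rewrite -/(wt rho) -/(wt sg) rhom sgm ltnn.
    case: ifP => // /forallP eqs _; apply/ffunP => i; apply/val_inj/eqP.
    by have := eqs i.
  (* Exchanging the entries at [i] preserves the product [U sg * U rho] on the Segre variety and
     lowers the weight of [rho]. *)
  pose sg' : Idx := [ffun i' => if i' == i then rho i' else sg i'].
  pose rho' : Idx := [ffun i' => if i' == i then sg i' else rho i'].
  have Rrho : radical I (U rho').
    apply: (IH (wt rho')) => //; rewrite -rhom /wt (bigD1 i)//= [X in (_ < X)%N](bigD1 i)//=.
    rewrite ffunE eqxx (eq_bigr (fun i' => rho i' : nat)) ?ltn_add2r//.
    by move=> i' /negPf i'i; rewrite ffunE i'i.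
  rewrite -[U sg * U rho](subrK (U sg' * U rho')); apply: (RD); last exact: RM.
  apply: sub_radical; apply: add_ideal_sub => w.
  rewrite mevalB !mevalM !UE -!big_split; apply/eqP; rewrite subr_eq0; apply/eqP.
  apply: eq_bigr => i' _ /=; rewrite !ffunE; case: eqP => // _.
  exact: mulrC.
apply: (finite_over_add_ideal vi).
- by move=> f d; apply: vanishing_pihomog; apply: segre_conic.
- by move=> s; apply: segre_form_homog.
move=> J; suff [d h] : radical I ('X_J) by exists d.
apply: (radical_exp (e := T.+1)).
(* A power of a Segre coordinate is the product over [i] of the finiteness relations; expanding it
   yields multiples of the [U sg]. *)
have /choice[q qE] : forall i, exists q : 'I_n.+1 -> {mpoly F[n.+1]},
    (forall s, q s \is T.-homog) /\ forall w : cone_prod Z,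
    (sval w i (idx J i) 0) ^+ T.+1 =
    \sum_s (V i s).@[fun l => sval w i l 0] * (q s).@[fun l => sval w i l 0].
  move=> i; have [q [qT qv]] := fin i (idx J i).
  exists (fun s => if (s <= a i)%N then q (inord s) else 0); split=> [s|w].
    by case: ifP => // _; apply: rpred0.
  have := qv (exist _ _ (svalP w i)); rewrite mevalB rmorphXn /= mevalXU.
  move=> /eqP; rewrite subr_eq0 => /eqP ->; rewrite raddf_sum /=.
  have an : ((a i).+1 <= n.+1)%N by apply: (leq_trans _ he); rewrite ltnS.
  pose g s := (u i (inord s) * q (inord s)).@[fun l => sval w i l 0].
  transitivity (\sum_(s < (a i).+1) g s).
    by apply: eq_bigr => s _; rewrite /g inord_val.
  rewrite (big_ord_widen _ g an) /g.
  rewrite big_mkcond; apply: eq_bigr => s _ /=; rewrite ltnS /V.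
  by case: ifP => _; rewrite ?mevalM// meval0 mul0r.
have /choice[Q QE] : forall sg : Idx, exists Q, forall w : cone_prod Z,
    Q.@[segre w] = \prod_i (q i (sg i)).@[fun l => sval w i l 0].
  by move=> sg; apply: (@segre_lift _ _ _ _ T) => i; apply: (qE i).1.
rewrite -['X_J ^+ _](subrK (\sum_sg U sg * Q sg)); apply: (RD); last first.
  by apply: ideal_sum => // sg _; rewrite mulrC; apply: (RM); apply: RU.
apply: sub_radical; apply: add_ideal_sub => w; apply/eqP.
rewrite mevalB subr_eq0 rmorphXn /= mevalXU /segre -prodrXl; apply/eqP.
under eq_bigr => i _ do rewrite (qE i).2.
rewrite bigA_distr_bigA raddf_sum; apply: eq_bigr => sg _ /=.
by rewrite mevalM UE QE big_split.
Qed.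

Lemma segre_alg_indep Z (a : 'I_k -> nat)
    (u : forall i, 'I_(a i).+1 -> {mpoly F[n.+1]}) :
  (0 < k)%N -> (forall i s, u i s \is 1.-homog) ->
  (forall i (b : 'I_(a i).+1 -> F), (exists s, b s != 0) ->
     exists x : {x | cone (Z i) x}, forall s, (u i s).@[cone_pt x] = b s) ->
  exists z : 'I_(\sum_i a i).+1 -> {mpoly F[_]},
    (forall s, z s \is 1.-homog) /\ alg_indep (@segre _ _ _ Z) z.
Proof.
(* [None] stands for the product of all [u i ord0]; any other index replaces one factor by another
   [u i s]. The ratios to the first form are independent affine coordinates on the product. *)
move=> k0 u1 usurj; pose P := option {i : 'I_k & 'I_(a i)}.
have cP : #|{: P}| = (\sum_i a i).+1.
  rewrite card_option card_tagged sumnE big_map big_enum; congr _.+1.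
  by apply: eq_bigr => i _; rewrite card_ord.
rewrite -cP.
pose v (q : P) i : {mpoly F[n.+1]} := if q is Some (existT i' s) then
    if i =P i' is ReflectT e then u i (lift ord0 (ecast i' 'I_(a i') (esym e) s)) else u i ord0
  else u i ord0.
have v1 q i : v q i \is 1.-homog.
  by rewrite /v; case: q => [[i' s]|]//; case: eqP.
exists (fun s => segre_form (v (enum_val s))); split.
  by move=> s; apply: segre_form_homog.
move=> G Gv; apply/eqP/negPn/negP => G0; pose s0 : 'I_#|{: P}| := enum_rank None.
have /mpoly_nonroot[b] : G * 'X_s0 != 0.
  by rewrite mulf_neq0// -msize_poly_eq0 msizeX mdeg1.
rewrite mevalM mevalXU mulf_eq0 negb_or => /andP[/eqP Gb b0]; apply: Gb.
(* The affine chart with [u i ord0] equal to 1; the factor [b s0] is restored afterwards by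
   rescaling. *)
pose b' i (s : 'I_(a i).+1) :=
  if unlift ord0 s is Some s' then b (enum_rank (Some (existT _ i s'))) / b s0 else 1.
have /choice[x xE] : forall i, exists x, cone (Z i) x /\
    forall s, (u i s).@[fun l => x l 0] = b' i s.
  move=> i; have [|[x Zx] h] := usurj i (b' i); last by exists x.
  by exists ord0; rewrite /b' unlift_none oner_neq0.
pose w : cone_prod Z := exist _ x (fun i => (xE i).1).
have wE q : (segre_form (v q)).@[segre w] = b (enum_rank q) / b s0.
  rewrite segre_form_eval//=; case: q => [[i s]|]; last first.
    rewrite divff// big1// => i _; rewrite /v (xE i).2 /b' unlift_none//.
  rewrite (bigD1 i)//= big1 ?mulr1.
    rewrite /v; case: eqP => // e; rewrite (xE i).2 /b' liftK.
    by rewrite (eq_axiomK e).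
  move=> i' i'i; rewrite /v; case: eqP => [e|_]; first by rewrite e eqxx in i'i.
  by rewrite (xE i').2 /b' unlift_none.
have [w' w'E] := segre_conic k0 w b0.
rewrite -(Gv w'); apply: meval_eq => s.
rewrite (meval_eq _ w'E) (meval_scale _ _ (segre_form_homog _)) expr1 wE enum_valK.
by rewrite mulrCA divff// mulr1.
Qed.

End SegreProjection.

(** * The open condition on tuples of matrices *)

Section GeneralTranslates.
Context (F : numClosedFieldType) (n k : nat).
Implicit Types (Z : 'I_k -> set (point F n)).

Lemma sum_truncation (d : 'I_k -> nat) e : (e <= \sum_i d i)%N ->
  exists2 a : 'I_k -> nat, (forall i, a i <= d i)%N & e = (\sum_i a i)%N.
Proof.
move=> ed; have [m dE] : exists m, (\sum_i d i = m + e)%N.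
  by exists (\sum_i d i - e)%N; rewrite subnK.
elim: m d dE {ed} => [|m IH] d dE; first by exists d.
have [i di] : exists i, d i != 0%N.
  apply: contrapT => /forallNP h; move: dE; rewrite big1// => i _.
  by apply/eqP/negPn/negP; apply: h.
have [|a ad ->] := IH (fun j => if j == i then (d j).-1 else d j).
  move: dE; rewrite (bigD1 i)//= [in X in _ -> X](bigD1 i)//= eqxx.
  rewrite [X in (_ + X)%N](eq_bigr (fun j => if j == i then (d j).-1 else d j)).
    by rewrite -[X in (X + _)%N = (_ + e)%N -> _](prednK (n := d i)) ?lt0n// !addSn => -[].
  by move=> j /negPf ->.
exists a => // j; apply: leq_trans (ad j) _; case: eqP => // _.
exact: leq_pred.
Qed.

Definition matrix_entries (A : 'I_k -> 'M[F]_n.+1) : 'I_(k * (n.+1 * n.+1)) -> F :=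
  fun a => mxvec (\matrix_(i < k) mxvec (A i)) 0 a.

Definition entry_index (i : 'I_k) (j l : 'I_n.+1) : 'I_(k * (n.+1 * n.+1)) :=
  mxvec_index i (mxvec_index j l).

Lemma matrix_entriesE A i j l : matrix_entries A (entry_index i j l) = A i j l.
Proof. by rewrite /matrix_entries /entry_index mxvecE mxE mxvecE. Qed.

Lemma matrix_entries_surj v : exists A, matrix_entries A =1 v.
Proof.
exists (fun i => \matrix_(j, l) v (entry_index i j l)) => a.
case/mxvec_indexP: a => i b; case/mxvec_indexP: b => j l.
by rewrite -/(entry_index i j l) matrix_entriesE mxE.
Qed.

(** The product of the determinants, non-zero at the tuple of identities; it serves to find
    invertible matrices in a non-empty open set of matrix tuples. *)
Lemma entry_poly_unit : exists2 D : {mpoly F[k * (n.+1 * n.+1)]}, D != 0 &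
  forall A, D.@[matrix_entries A] != 0 -> forall i, A i \in unitmx.
Proof.
pose d i : {mpoly F[k * (n.+1 * n.+1)]} := \det (\matrix_(j, l) 'X_(entry_index i j l)).
have dE i A : (d i).@[matrix_entries A] = \det (A i).
  rewrite /d -det_map_mx; congr (\det _); apply/matrixP => j l.
  by rewrite !mxE /= mevalXU matrix_entriesE.
exists (\prod_i d i).
  apply/prodf_neq0 => i _; apply/eqP => di; have := dE i (fun=> 1%:M).
  by rewrite di meval0 det1 => /eqP; rewrite eq_sym oner_eq0.
move=> A; rewrite rmorph_prod /= => /prodf_neq0 h i.
by rewrite unitmxE unitfE -dE h.
Qed.

(* The determinant is that of [finite_over_open]; its entries are multiplied by
   a common scalar when the matrices are rescaled. *)
Lemma general_projection Z (a : 'I_k -> nat) (e T : nat)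
    (u : forall i, 'I_(a i).+1 -> {mpoly F[n.+1]}) (he : (e.+1 <= n.+1)%N) :
  (0 < k)%N -> e = (\sum_i a i)%N -> (forall i s, u i s \is 1.-homog) ->
  (forall i, finite_over (vanishing (@cone_pt _ _ (Z i))) (u i) T) ->
  exists D : {mpoly F[k * (n.+1 * n.+1)]},
    [/\ D != 0,
        forall A B t, (forall i, t i != 0 /\ A i = t i *: B i) ->
          D.@[matrix_entries A] != 0 -> D.@[matrix_entries B] != 0
      & forall A, D.@[matrix_entries A] != 0 ->
          exists T', finite_over (vanishing (@segre _ _ _ Z))
            (fun s : 'I_e.+1 => hadamard_form A (widen_ord he s)) T'].
Proof.
move=> k0 eE u1 fin; pose y (A : 'I_k -> 'M[F]_n.+1) s := hadamard_form A (widen_ord he s).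
have [A0 [T0 fin0]] := special_projection he k0 eE u1 fin.
have y1 A s : y A s \is 1.-homog by apply: segre_form_homog.
have [r [pts [q [D0 Dopen]]]] := finite_over_open (segre_conic k0) (y1 A0) fin0.
pose M A : 'M[F]_r := \matrix_(b, c)
  \sum_s (y A s).@[segre (pts c)] * (q b s).@[segre (pts c)].
pose D : {mpoly F[k * (n.+1 * n.+1)]} := \det (\matrix_(b < r, c < r) \sum_s
  (\prod_i \sum_l (sval (pts c) i l 0)%:MP * 'X_(entry_index i (widen_ord he s) l))
  * ((q b s).@[segre (pts c)])%:MP).
have DE A : D.@[matrix_entries A] = \det (M A).
  rewrite /D -det_map_mx; congr (\det _); apply/matrixP => b c.
  rewrite !mxE raddf_sum; apply: eq_bigr => s _.
  rewrite /= mevalM mevalC hadamard_form_eval; congr (_ * _).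
  rewrite rmorph_prod; apply: eq_bigr => i _.
  rewrite /= raddf_sum mxE; apply: eq_bigr => l _.
  by rewrite /= mevalM mevalC mevalXU matrix_entriesE mulrC.
exists D; split.
- by apply/eqP => D0'; move/eqP: D0; apply; rewrite -[LHS](DE A0) D0' meval0.
- move=> A B t tAB; rewrite !DE.
  have -> : M A = (\prod_i t i) *: M B.
    apply/matrixP => b c; rewrite !mxE mulr_sumr; apply: eq_bigr => s _.
    rewrite mulrA; congr (_ * _); rewrite !hadamard_form_eval -big_split.
    by apply: eq_bigr => i _; rewrite /= (tAB i).2 -scalemxAl mxE.
  by rewrite detZ; apply: contra => /eqP ->; rewrite mulr0.
- by move=> A; rewrite DE; apply: Dopen.
Qed.

(** A dependence would let one form be eliminated with finiteness preserved; the growth exponent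
    would drop to e - 1, against the e + 1 independent forms of [segre_alg_indep]. *)
Lemma projection_alg_indep Z (a : 'I_k -> nat) (e T : nat)
    (u : forall i, 'I_(a i).+1 -> {mpoly F[n.+1]}) (y : 'I_e.+1 -> {mpoly F[_]}) :
  (0 < k)%N -> e = (\sum_i a i)%N -> (forall i s, u i s \is 1.-homog) ->
  (forall i (b : 'I_(a i).+1 -> F), (exists s, b s != 0) ->
     exists x : {x | cone (Z i) x}, forall s, (u i s).@[cone_pt x] = b s) ->
  (forall s, y s \is 1.-homog) ->
  finite_over (vanishing (@segre _ _ _ Z)) y T -> alg_indep (@segre _ _ _ Z) y.
Proof.
move=> k0 eE u1 usurj y1 fin.
have [z [z1 zind]] := segre_alg_indep k0 u1 usurj; rewrite -eE in z z1 zind *.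
have [W0] : inhabited (cone_prod Z).
  apply: contrapT => W0; have /eqP : (1 : {mpoly F[e.+1]}) = 0.
    by apply: zind => w; case: W0.
  by rewrite oner_eq0.
apply: contrapT => /(noether_step (segre_conic k0) (inhabits W0) y1 fin).
case: e {eE y y1 fin} z z1 zind => [|e] z z1 zind [u' [T' [_ fin']]].
  (* For e = 0 no form would be left, although some Segre coordinate is non-zero. *)
  have [J WJ] := segre_neq0 W0; have [q [_ /(_ W0)]] := fin' J.
  rewrite big_ord0 subr0 rmorphXn /= mevalXU => /eqP.
  by rewrite expf_eq0 (negPf WJ) andbF.
by have := alg_indep_growth z1 zind (finite_over_growth fin'); rewrite ltnn.
Qed.

End GeneralTranslates.

(** * Dimension of the Hadamard product of general translates *)

Section Main.
Context (F : numClosedFieldType) (n k : nat).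

Lemma hadamard_dim (A : 'I_k -> GL F n.+1) (X Z : 'I_k -> set (point F n))
    (d : 'I_k -> nat) (he : ((minn n (\sum_i d i)).+1 <= n.+1)%N) :
  (0 < k)%N -> (forall i, Z i `<=` X i) ->
  (forall i, zariski_closed (X i)) -> (forall i, has_dim (X i) (d i)) ->
  alg_indep (@segre _ _ _ Z) (fun s : 'I_(minn n (\sum_i d i)).+1 =>
    hadamard_form (fun i => val (A i)) (widen_ord he s)) ->
  let gX i := image_by (\pi_(PGL F n.+1) (A i)) (X i) in
  hadamard_products gX !=set0 /\ has_dim (hadamard gX) (minn n (\sum_i d i)).
Proof.
set e := minn n _ in he * => k0 ZX Xc Xd yind gX; set H := hadamard gX.
have ZXw (w : cone_prod Z) : exists w' : cone_prod X, forall j,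
    hadamard_map (fun i => val (A i)) w' j = hadamard_map (fun i => val (A i)) w j.
  have h i : cone (X i) (sval w i).
    by have [p Zp pw] := svalP w i; exists p => //; apply: ZX.
  by exists (exist _ (sval w) h).
have prodP (w : cone_prod Z) : hadamard_map (fun i => val (A i)) w (widen_ord he ord0) != 0 ->
    exists q y, [/\ hadamard_products gX q, coords q y &
      forall j, y j 0 = hadamard_map (fun i => val (A i)) w j].
  have [w' w'E] := ZXw w; rewrite -w'E => /hadamard_map_products[q [y [qX qy yE]]].
  by exists q, y; split => // j; rewrite yE.
have HX0 : hadamard_products gX !=set0.
  have [w w0] : exists w : cone_prod Z,
      hadamard_map (fun i => val (A i)) w (widen_ord he ord0) != 0.
    (* If the first coordinate were identically zero, the first variable would be a relation. *)
    apply: contrapT => /forallNP h; have /eqP : ('X_ord0 : {mpoly F[e.+1]}) = 0.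
      apply: yind => w; rewrite mevalXU hadamard_form_eval.
      by apply/eqP/negPn/negP; apply: h.
    by rewrite -msize_poly_eq0 msizeX mdeg1.
  by have [q [y [qX _ _]]] := prodP w w0; exists q.
split => //; split; last first.
  move=> m Hm; rewrite leq_min; apply/andP; split.
    by apply: chain_le_growth Hm _ (hgrowth_ambient _) => f; apply: hadamard_vanishing.
  apply: chain_le_growth Hm _ (hadamard_map_growth _ _) => [f|i].
    exact: hadamard_vanishing.
  by have [u [T [_ fin _]]] := has_dim_noether (Xc i) (Xd i); apply: finite_over_growth fin.
have Hc : zariski_closed H by apply: zariski_closure_closed.
have H0 : H !=set0 by have [q qX] := HX0; exists q; apply: sub_zariski_closure.
have [m [u [T [u1 fin ind]]]] := closed_noether Hc H0.
apply: has_chain_le (finite_over_chain Hc fin ind u1).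
(* Lower bound: the first e + 1 coordinates are shown independent on [H], so its number of Noether
   parameters is at least e + 1. *)
have z1 (s : 'I_e.+1) : ('X_(widen_ord he s) : {mpoly F[n.+1]}) \is 1.-homog.
  by rewrite dhomogX /= mdeg1.
rewrite -ltnS; apply: alg_indep_growth z1 _ (finite_over_growth fin) => G Gv.
(* The factor ['X_ord0] covers the tuples whose first product coordinate vanishes, which may define
   no point of [H]. *)
have /eqP : G * 'X_ord0 = 0.
  apply: yind => w; rewrite mevalM mevalXU hadamard_form_eval.
  have [->|w0] := eqVneq (hadamard_map (fun i => val (A i)) w (widen_ord he ord0)) 0.
    by rewrite mulr0.
  have [q [y [qX qy yE]]] := prodP w w0.
  have Hy : cone H y by exists q => //; apply: sub_zariski_closure.
  rewrite (meval_eq (v2 := fun s => ('X_(widen_ord he s)).@[cone_pt (exist _ y Hy)])).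
    by rewrite Gv mul0r.
  by move=> s; rewrite hadamard_form_eval mevalXU /cone_pt /= yE.
rewrite mulf_eq0 => /orP[/eqP//|].
by rewrite -msize_poly_eq0 msizeX mdeg1.
Qed.

Lemma general_hadamard_dim (X : 'I_k -> set (point F n)) (d : 'I_k -> nat) :
  (0 < k)%N -> (forall i, zariski_closed (X i)) -> (forall i, has_dim (X i) (d i)) ->
  exists U : set ('I_k -> PGL F n.+1),
    zariski_open_PGL U /\ U !=set0 /\
    forall g : 'I_k -> PGL F n.+1, U g ->
      hadamard_products (fun i => image_by (g i) (X i)) !=set0 /\
      has_dim (hadamard (fun i => image_by (g i) (X i))) (minn n (\sum_(i < k) d i)).
Proof.
move=> k0 Xc Xd; set e := minn n _.
have [a ad eE] := sum_truncation (geq_minr n (\sum_i d i)).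
have he : (e.+1 <= n.+1)%N by rewrite ltnS geq_minl.
have secP i : exists Zu : set (point F n) * ('I_(a i).+1 -> {mpoly F[n.+1]}) * nat,
    [/\ Zu.1.1 `<=` X i, forall s, Zu.1.2 s \is 1.-homog,
        finite_over (vanishing (@cone_pt _ _ Zu.1.1)) Zu.1.2 Zu.2 &
        forall b : 'I_(a i).+1 -> F, (exists s, b s != 0) ->
          exists w : {x | cone Zu.1.1 x}, forall s, (Zu.1.2 s).@[cone_pt w] = b s].
  have [u [T [u1 fin ind]]] := has_dim_noether (Xc i) (Xd i).
  have [Z [v [ZX v1 vfin vb]]] := linear_section (ad i) (Xc i) u1 fin ind.
  by exists (Z, v, T).
pose Z i := (projT1 (cid (secP i))).1.1; pose u i := (projT1 (cid (secP i))).1.2.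
(* The sum is a common bound for the finiteness exponents of all sections. *)
pose T := (\sum_i (projT1 (cid (secP i))).2)%N.
have ZX i : Z i `<=` X i by case: (projT2 (cid (secP i))).
have u1 i s : u i s \is 1.-homog by case: (projT2 (cid (secP i))) => _ + _ _; apply.
have fin i : finite_over (vanishing (@cone_pt _ _ (Z i))) (u i) T.
  case: (projT2 (cid (secP i))) => _ _ + _; apply: finite_over_le.
    exact: vanishing_ideal.
  by rewrite /T (bigD1 i)//= leq_addr.
have usurj i (b : 'I_(a i).+1 -> F) : (exists s, b s != 0) ->
     exists x : {x | cone (Z i) x}, forall s, (u i s).@[cone_pt x] = b s.
  by case: (projT2 (cid (secP i))) => _ _ _; apply.
have [D [D0 Dscale Dfin]] := general_projection he k0 eE u1 fin.
(* The condition [D] non-zero does not depend on the representatives, by [Dscale], so it cuts out an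
   open set in the quotient. *)
exists [set g | exists2 A : 'I_k -> GL F n.+1,
  g = (fun i => \pi_(PGL F n.+1) (A i)) & D.@[entries A] != 0]; split; [|split].
- exists [set D] => A; split=> [[B AB DB]|[_ -> DA]]; last by exists A.
  exists D => //; have /choice[t tP] : forall i, exists t : F, t != 0 /\ val (B i) = t *: val (A i).
    move=> i; have [|t t0 tE] := (PGL_eqP (B i) (A i)).1; last by exists t.
    by rewrite (congr1 (fun g => g i) AB).
  exact: (Dscale _ _ t tP DB).
(* [D] is known to be non-zero only as a polynomial; multiplying by [E] provides a tuple of
   invertible matrices where it does not vanish. *)
- have [E E0 Eunit] := @entry_poly_unit F n k.
  have /mpoly_nonroot[v] : D * E != 0 by rewrite mulf_neq0.
  have [A AE] := matrix_entries_surj v.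
  rewrite -(meval_eq _ AE) mevalM mulf_eq0 negb_or => /andP[DA /Eunit Au].
  exists (fun i => \pi_(PGL F n.+1) (exist _ (A i) (Au i) : GL F n.+1)).
  by exists (fun i => exist _ (A i) (Au i)).
- move=> _ [A -> DA]; apply: (@hadamard_dim A X Z d he) => //.
  have [T' finA] := Dfin _ DA.
  apply: (projection_alg_indep k0 eE u1 usurj _ finA) => s.
  exact: segre_form_homog.
Qed.

End Main.

Theorem theorem1p2 (R : realType) (n k : nat) (hk : (2 <= k)%N)
    (X : 'I_k -> set (point R[i] n))
    (hX : forall i, integral_variety (X i))
    (d : 'I_k -> nat) (hd : forall i, has_dim (X i) (d i)) :
  exists U : set ('I_k -> PGL R[i] n.+1),
    zariski_open_PGL U /\ U !=set0 /\
    forall g : 'I_k -> PGL R[i] n.+1, U g ->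
      hadamard_products (fun i => image_by (g i) (X i)) !=set0 /\
      has_dim (hadamard (fun i => image_by (g i) (X i)))
              (minn n (\sum_(i < k) d i)).
Proof.
apply: general_hadamard_dim => //; first exact: ltnW.
by move=> i; case: (hX i).
Qed.
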